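(* $R_3(P_9) \le 17$.
   Context: All graphs are undirected, finite, with no loops or multiple edges. $P_k$ denotes the path on $k$ vertices, and $K_N$ denotes the complete graph on $N$ vertices. For a graph $G$, the three-color diagonal Ramsey number $R_3(G) = R(G,G,G)$ is the smallest integer $N$ such that every coloring of the edges of $K_N$ with 3 colors contains a monochromatic copy of $G$ (as a not necessarily induced subgraph), i.e. there is a color $i \in \{1,2,3\}$ such that the graph formed by the edges of color $i$ contains a subgraph isomorphic to $G$. *)

(* Defs.v *)
From mathcomp Require Import all_boot.
From mathcomp Require Import zify.

Set Implicit Arguments.
Unset Strict Implicit.
Unset Printing Implicit Defensive.

Record sgraph := SGraph {
  vertex :> finType;
  adj : rel vertex;
  adj_sym : symmetric adj;
  adj_irr : irreflexive adj }.

Lemma complete_sym N : symmetric [rel x y : 'I_N | x != y].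
Proof. by move=> x y /=; rewrite eq_sym. Qed.

Lemma complete_irr N : irreflexive [rel x y : 'I_N | x != y].
Proof. by move=> x /=; rewrite eqxx. Qed.

Definition complete_graph (N : nat) : sgraph :=
  SGraph (@complete_sym N) (@complete_irr N).

Lemma path_sym k :
  symmetric [rel i j : 'I_k | (i.+1 == j :> nat) || (j.+1 == i :> nat)].
Proof. by move=> i j /=; rewrite orbC. Qed.

Lemma path_irr k :
  irreflexive [rel i j : 'I_k | (i.+1 == j :> nat) || (j.+1 == i :> nat)].
Proof. by move=> i /=; rewrite orbb; lia. Qed.

Definition path_graph (k : nat) : sgraph :=
  SGraph (@path_sym k) (@path_irr k).

(* "H contains a subgraph isomorphic to G", not necessarily induced. *)
Definition contains (H G : sgraph) : bool :=
  [exists f : {ffun G -> H},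
     injectiveb f && [forall x, forall y, adj x y ==> adj (f x) (f y)]].

(* The colour of the edge xy is c [set x; y]; the values of c on sets that are
   not edges of H are never used. *)
Definition coloring (H : sgraph) := {ffun {set H} -> 'I_3}.

Lemma color_class_sym (H : sgraph) (c : coloring H) (i : 'I_3) :
  symmetric [rel x y : H | adj x y && (c [set x; y] == i)].
Proof. by move=> x y /=; rewrite adj_sym setUC. Qed.

Lemma color_class_irr (H : sgraph) (c : coloring H) (i : 'I_3) :
  irreflexive [rel x y : H | adj x y && (c [set x; y] == i)].
Proof. by move=> x /=; rewrite adj_irr. Qed.

Definition color_class (H : sgraph) (c : coloring H) (i : 'I_3) : sgraph :=
  SGraph (color_class_sym c i) (color_class_irr c i).

Definition arrows3 (N : nat) (G : sgraph) : bool :=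
  [forall c : coloring (complete_graph N),
     [exists i : 'I_3, contains (color_class c i) G]].

Fixpoint ramsey_bound (m : nat) : nat :=
  if m is m'.+1 then (3 * ramsey_bound m').+1 else 0.

(* Off-diagonal Ramsey theorem for cliques. *)
Lemma ramsey_clique (T : finType) (c : {set T} -> 'I_3) (m : nat)
    (k : 'I_3 -> nat) (A : {set T}) :
  \sum_i k i = m -> ramsey_bound m <= #|A| ->
  exists i : 'I_3, exists2 S : {set T}, S \subset A &
    k i <= #|S| /\ {in S &, forall x y, x != y -> c [set x; y] = i}.
Proof.
elim: m k A => [|m IHm] k A sum_k leA.
  exists ord0, set0; rewrite ?sub0set //; split=> [|x y]; last by rewrite inE.
  by move/eqP: sum_k; rewrite sum_nat_eq0 => /forallP/(_ ord0)/eqP->.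
have /card_gt0P[v Av] : 0 < #|A| by apply: leq_trans leA.
pose B i := [set u in A :\ v | c [set v; u] == i].
have [i leBi] : exists i, ramsey_bound m <= #|B i|.
  apply/existsP; apply: contraLR leA; rewrite negb_exists -ltnNge => /forallP ltB.
  rewrite (cardsD1 v A) Av /= add1n ltnS.
  have -> : #|A :\ v| = \sum_i #|B i|.
    rewrite -sum1_card (partition_big (fun u => c [set v; u]) predT) //=.
    by apply: eq_bigr => i _; rewrite -sum1_card; apply: eq_bigl => u; rewrite !inE.
  case: (ramsey_bound m) ltB => [/(_ ord0)//|b ltB].
  suff: \sum_i #|B i| <= 3 * b by lia.
  rewrite -[X in X * b](card_ord 3) -sum_nat_const; apply: leq_sum => i _.
  by move: (ltB i); rewrite -ltnNge ltnS.
have [ki0|ki_gt0] := posnP (k i).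
  exists i, set0; rewrite ?sub0set ?ki0 //; split=> // x y; by rewrite inE.
pose k' j := if j == i then (k i).-1 else k j.
have sum_k' : \sum_j k' j = m.
  apply/eqP; rewrite -eqSS -sum_k (bigD1 i) //= [X in _ == X](bigD1 i) //= /k' eqxx.
  rewrite -addSn prednK //; apply/eqP; congr (_ + _).
  by apply: eq_bigr => j /negPf->.
have [j [S sSB [leS Smono]]] := IHm k' (B i) sum_k' leBi.
have sSA : S \subset A.
  by apply: subset_trans sSB _; apply/subsetP => u; rewrite !inE => /andP[/andP[]].
have [ji|neq_ji] := eqVneq j i; last first.
  by exists j, S => //; split=> //; move: leS; rewrite /k' (negPf neq_ji).
have BS u : u \in S -> u != v /\ c [set v; u] = i.
  by move/(subsetP sSB); rewrite !inE => /andP[/andP[-> _] /eqP].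
exists i, (v |: S); first by rewrite subUset sub1set Av.
split.
  rewrite cardsU1; have -> : v \notin S by apply/negP => /BS[]; rewrite eqxx.
  by move: leS; rewrite /k' ji eqxx; lia.
move=> x y; rewrite !inE => /predU1P[->|Sx] /predU1P[->|Sy] neq_xy.
- by rewrite eqxx in neq_xy.
- by have [] := BS _ Sy.
- by rewrite setUC; have [] := BS _ Sx.
- by rewrite -ji; apply: Smono.
Qed.

Lemma ramsey3_exists (G : sgraph) : exists N, arrows3 N G.
Proof.
exists (ramsey_bound (\sum_(i < 3) #|G|)); set N := ramsey_bound _.
apply/forallP => c.
have leN : N <= #|[set: complete_graph N]| by rewrite cardsT card_ord.
have [i [S _ [leS Smono]]] := ramsey_clique c (erefl _) leN.
apply/existsP; exists i; apply/existsP.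
pose f (x : G) := enum_val (widen_ord leS (enum_rank x)).
have f_inj : injective f by move=> x y /enum_val_inj/(congr1 val)/= /val_inj/enum_rank_inj.
exists [ffun x => f x]; apply/andP; split.
  by apply/injectiveP => x y; rewrite !ffunE => /f_inj.
apply/forallP => x; apply/forallP => y; apply/implyP => xy; rewrite !ffunE /=.
have neq_f : f x != f y.
  by apply: contraTneq xy => /f_inj->; rewrite adj_irr.
by rewrite neq_f (Smono _ _ (enum_valP _) (enum_valP _) neq_f) eqxx.
Qed.

Definition R3 (G : sgraph) : nat := ex_minn (ramsey3_exists G).

(* Main.v *)
(* Suppose no colour contains P_9. One colour, G, has at least 46 of the 136 edges; a
   3-degenerate graph on 17 vertices has at most 45, so the 4-core of G is non-empty.
   The vertices of a longest path in the core form a component of the core, of size 5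
   to 8, and a core component with at most 7 vertices is Hamilton-connected. Counting
   edges along the removal of vertices of degree at most 3 then leaves three possibilities.
   - G has a union of components with 7 or 8 vertices. Between it and the remaining
     vertices the other two colours colour a K_{7,9}; by pigeonhole, 5 of the 9 vertices
     have 4 neighbours each in the same colour among the 7, which forces a P_9.
   - The core has 6 vertices: the outside vertices are too well attached to avoid a P_9.
   - The core is a K_5 and the 12 outside vertices are independent and all joined to the
     same 3 of its vertices, so G has an independent set of size 13. One of the other
     colours has 39 of the 78 edges inside it, but a P_9-free graph on 13 vertices has at
     most 3 * 13 - 3 edges, or at most 38 if it has a union of components of size 7 or 8.
   The small extension steps are finite case analyses, carried out by a verified search. *)
Require Import Defs.
From mathcomp Require Import all_boot zify.
Set Implicit Arguments.
Unset Strict Implicit.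
Unset Printing Implicit Defensive.

(** * Verified search for long paths *)

(* [has] and [mem] go through [orb], which the virtual machine evaluates without
   short-circuiting. *)
Fixpoint lazy_has (A : Type) (f : A -> bool) (s : seq A) : bool :=
  if s is x :: s' then (if f x then true else lazy_has f s') else false.

Fixpoint nat_mem (x : nat) (s : seq nat) : bool :=
  if s is y :: s' then (if eqn x y then true else nat_mem x s') else false.

Lemma lazy_hasE A (f : A -> bool) s : lazy_has f s = has f s.
Proof. by elim: s => //= x s ->; case: (f x). Qed.

Lemma nat_memE x s : nat_mem x s = (x \in s).
Proof. by elim: s => //= y s ->; rewrite inE -[eqn x y]/(x == y); case: (x == y). Qed.

Section Search.
Variables (lo fuel : nat) (starts : seq nat) (fin : pred nat).
Variables (b : nat) (cs : seq (nat * nat)).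

(* [k] is fuel; [d] counts the vertices still missing before [fin] may be tested. *)
Fixpoint dfs k d (ad : seq (seq nat)) (used : seq nat) (v : nat) : bool :=
  if (if d is 0 then fin v else false) then true
  else if k is k'.+1 then
    lazy_has (fun w => if nat_mem w used then false
                       else dfs k' d.-1 ad (w :: used) w) (nth [::] ad v)
  else false.

Definition add_edge (ad : seq (seq nat)) (i j : nat) :=
  let ad' := set_nth [::] ad i (j :: nth [::] ad i) in
  set_nth [::] ad' j (i :: nth [::] ad' j).

Definition found ad := lazy_has (fun s => dfs fuel lo ad [:: s] s) starts.

(* [(i, d)] in [cs] stands for: vertex [i] has at least [d] neighbours among
   [0, ..., b.-1]. *)
Definition conflict (nad : seq (seq nat)) :=
  lazy_has (fun c : nat * nat =>
    count (fun j => ~~ nat_mem j (c.1 :: nth [::] nad c.1)) (iota 0 b) < c.2) cs.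

(* Case analysis on the undecided pairs [todo]; [ad] and [nad] list the pairs known to
   be adjacent, resp. non-adjacent. Success means that every graph compatible with them
   and with [cs] contains a path with at least [lo] edges, from [starts] to [fin]. *)
Fixpoint search (todo : seq (nat * nat)) ad nad : bool :=
  if todo is (i, j) :: todo' then
    if (let ad' := add_edge ad i j in
        if found ad' then true else search todo' ad' nad)
    then (let nad' := add_edge nad i j in
          if conflict nad' then true else search todo' ad nad')
    else false
  else false.

Definition adj_of (es : seq (nat * nat)) :=
  foldr (fun p ad => add_edge ad p.1 p.2) [::] es.

Variable g : rel nat.
Hypotheses (g_sym : symmetric g) (g_irr : irreflexive g).
Hypothesis g_cs : all (fun c => c.2 <= count (g c.1) (iota 0 b)) cs.

Lemma dfs_path k d ad used v :
    (forall i j, j \in nth [::] ad i -> g i j) -> dfs k d ad used v ->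
  exists p, [/\ path g v p, uniq p, all (fun w => w \notin used) p,
                d <= size p & fin (last v p)].
Proof.
move=> adg; elim: k d used v => [|k IHk] d used v.
  by case: d => //=; case: ifP => // fv _; exists [::].
rewrite /=; case: ifP => [|_]; first by case: d => // fv _; exists [::].
rewrite lazy_hasE => /hasP[w vw]; rewrite nat_memE; case: ifP => // wu.
case/IHk=> p [pth up npu szp fp]; exists (w :: p); split=> //=.
- by rewrite (adg _ _ vw).
- rewrite up andbT; apply/negP => wp.
  by move/allP: npu => /(_ _ wp); rewrite inE eqxx.
- rewrite wu /=; apply/allP => z /(allP npu).
  by rewrite inE; case/norP.
- by case: d szp.
Qed.

Lemma add_edgeP (r : rel nat) ad i j : symmetric r -> r i j ->
    (forall k l, l \in nth [::] ad k -> r k l) ->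
  forall k l, l \in nth [::] (add_edge ad i j) k -> r k l.
Proof.
have add1 i' j' ad' : r i' j' -> (forall k l, l \in nth [::] ad' k -> r k l) ->
    forall k l, l \in nth [::] (set_nth [::] ad' i' (j' :: nth [::] ad' i')) k -> r k l.
  move=> rij adr k l; rewrite nth_set_nth /=; case: eqP => [->|_ /adr//].
  by rewrite inE => /predU1P[->|/adr].
by move=> rC rij adr; apply: (add1); [rewrite rC | apply: add1].
Qed.

Lemma conflictN nad : (forall i j, j \in nth [::] nad i -> ~~ g i j) -> ~~ conflict nad.
Proof.
move=> nadg; rewrite /conflict lazy_hasE; apply/hasPn => c /(allP g_cs) le_c.
rewrite -leqNgt; apply: leq_trans le_c _; apply: sub_count => j gij.
rewrite nat_memE inE; apply: contraL gij => /predU1P[->|/nadg//].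
by rewrite g_irr.
Qed.

(** The truth of [g] selects one branch at each pair. That branch never meets a conflict, by
    [conflictN], and an exhausted list counts as failure, so it can only stop at a path. *)
Lemma search_path todo ad nad :
    (forall i j, j \in nth [::] ad i -> g i j) ->
    (forall i j, j \in nth [::] nad i -> ~~ g i j) ->
    search todo ad nad ->
  exists s p, [/\ s \in starts, path g s p, uniq (s :: p),
                  lo <= size p & fin (last s p)].
Proof.
have ngC : symmetric (fun i j => ~~ g i j) by move=> i j; rewrite g_sym.
elim: todo ad nad => //= -[i j] todo IHt ad nad adg nadg.
case: ifP => // yes; case: (boolP (g i j)) => gij; last first.
  have nadg' := add_edgeP ngC gij nadg.
  by rewrite (negPf (conflictN nadg')); apply: IHt.
have adg' := add_edgeP g_sym gij adg.
move: yes; case: ifP => [|_ /IHt]; last by move=> /(_ adg' nadg).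
rewrite /found lazy_hasE => /hasP[s ss /(dfs_path adg')[p [pth up nps szp fp]]] _ _.
exists s, p; split=> //=; rewrite up andbT; apply/negP => sp.
by move/allP: nps => /(_ _ sp); rewrite inE eqxx.
Qed.

Lemma adj_ofP es : all (fun p => g p.1 p.2) es ->
  forall i j, j \in nth [::] (adj_of es) i -> g i j.
Proof.
elim: es => [_ i j|[i j] es IHes] /=; first by rewrite nth_nil.
by case/andP=> gij /IHes; apply: add_edgeP.
Qed.

End Search.

(** The numbers searched are positions in [A ++ B]. Degree conditions count neighbours in [A], which
    occupies the first positions. *)
Lemma search_sound (T : eqType) (e : rel T) (x0 : T) (A B : seq T)
    lo fuel starts fin cs es todo (vs := A ++ B) (v := nth x0 vs) :
    symmetric e -> irreflexive e -> uniq vs -> 0 < lo ->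
    all (fun p => [&& p.1 < size vs, p.2 < size vs & e (v p.1) (v p.2)]) es ->
    all (fun c => (c.1 < size vs) && (c.2 <= count (e (v c.1)) A)) cs ->
    search lo fuel starts fin (size A) cs todo (adj_of es) [::] ->
  exists s p, [/\ s \in starts, fin (last s p), lo <= size p,
    {subset map v (s :: p) <= vs} &
    uniq (map v (s :: p)) && path e (v s) (map v p)].
Proof.
move=> eC eI uvs lo_gt0 ges gcs.
(* Restricting to valid positions keeps the default value of [nth] from producing edges. *)
pose g := [rel i j | [&& i < size vs, j < size vs & e (v i) (v j)]].
have gC : symmetric g by move=> i j; rewrite /= eC andbCA.
have gI : irreflexive g by move=> i; rewrite /= eI !andbF.
have gcs' : all (fun c => c.2 <= count (g c.1) (iota 0 (size A))) cs.
  apply: sub_all gcs => -[i d] /= /andP[ltis /leq_trans-> //].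
  have {1}-> : A = map v (iota 0 (size A)).
    rewrite -{1}(mkseq_nth x0 A); apply/eq_in_map => j.
    by rewrite mem_iota /v nth_cat => /andP[_ ->].
  rewrite count_map; apply: eq_leq; apply: eq_in_count => j.
  rewrite mem_iota /= add0n => ltj; rewrite (ltis : i < size vs).
  by rewrite /vs size_cat (leq_trans ltj (leq_addr _ _)).
case/(search_path gC gI gcs'); first exact: adj_ofP.
  by move=> i j; rewrite nth_nil.
move=> s [p [ss pth usp szp fp]]; exists s, p.
have lt_sp : {in s :: p, forall i, i < size vs}.
  (* As [lo] is positive the path has an edge, so even its first vertex is an end of a [g]-edge and
     hence a valid position. *)
  case: p pth {usp fp} szp => [|w p]; first by rewrite leqNgt lo_gt0.
  move=> /= /andP[/and3P[lts ltw _] pth] _ i; rewrite !inE.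
  case/or3P=> [/eqP->//|/eqP->//|].
  elim: p w {ltw} pth => //= u p IHp w /andP[/and3P[_ ltu _] pth].
  by rewrite inE => /predU1P[->|/(IHp _ pth)].
split=> //.
  by move=> z /mapP[i isp ->]; rewrite mem_nth ?lt_sp.
rewrite map_inj_in_uniq ?usp /=; last first.
  by move=> i j /lt_sp ? /lt_sp ? /eqP; rewrite nth_uniq // => /eqP.
rewrite path_map; apply: sub_path pth => i j /=.
by case/and3P.
Qed.

(** * Finite case analyses settled by computation *)

Definition pairs (s : seq nat) := [seq p <- allpairs pair s s | p.1 < p.2].

Definition succ_pairs k := [seq (j, j.+1) | j <- iota 0 k].

(* Vertices [0, ..., k.-1] form a path whose ends have 4 neighbours on it; [k] is attached
   to [i]. *)
Definition longer_search k i :=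
  search k k (iota 0 k.+1) predT k [:: (0, 4); (k.-1, 4)]
    ([seq (0, j) | j <- iota 2 (k - 2)] ++ [seq (k.-1, j) | j <- iota 1 (k - 3)])
    (adj_of ((i, k) :: succ_pairs k.-1)) [::].

Lemma longer_search_true :
  all (fun k => all (longer_search k) (iota 0 k)) (iota 5 4).
Proof. by vm_cast_no_check (erefl true). Qed.

(* Minimum degree 4 on [c] vertices: a path from [0] to [k.-1] with [k] vertices can be
   lengthened without changing its ends. *)
Definition link_search c k :=
  search k c [:: 0] (eqn^~ k.-1) c [seq (i, 4) | i <- iota 0 c]
    (allpairs pair (iota k (c - k)) (iota 0 k) ++ pairs (iota k (c - k)))
    (adj_of (succ_pairs k.-1)) [::].

Lemma link_search_true :
  all (fun c => all (link_search c) (iota 2 (c - 2))) (iota 5 3).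
Proof. by vm_cast_no_check (erefl true). Qed.

(** The starting point for lengthening: 0 and 1 are not assumed adjacent, and any path between them
    will do. *)
Definition link2_search c :=
  search 1 c [:: 0] (eqn^~ 1) c [seq (i, 4) | i <- iota 0 c]
    ((0, 1) :: allpairs pair [:: 0; 1] (iota 2 (c - 2))) (adj_of [::]) [::].

Lemma link2_search_true : all link2_search (iota 5 3).
Proof. by vm_cast_no_check (erefl true). Qed.

(* A Hamiltonian path [0, ..., 5] of the 6-vertex core, with 6 and 7 attached to its ends,
   and a further outer vertex 8. *)
Lemma end_search6 :
  search 8 8 (iota 6 3) predT 6 ([seq (j, 4) | j <- iota 0 6] ++ [:: (6, 3); (7, 3); (8, 3)])
    (allpairs pair [:: 8] (iota 0 6) ++ pairs (iota 0 6) ++ allpairs pair [:: 6; 7] (iota 0 6))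
    (adj_of [:: (6, 0), (5, 7) & succ_pairs 5]) [::].
Proof. by vm_cast_no_check (erefl true). Qed.

(* A clique [0, ..., 4]; the outer vertices 5, 6, 7 have 3 neighbours in it, and 8 is
   attached to 5. *)
Lemma end_search5 :
  search 8 8 [:: 8] predT 5 [:: (6, 3); (7, 3)] (allpairs pair [:: 6; 7] (iota 0 5))
    (adj_of ((5, 8) :: [seq (5, j) | j <- iota 0 3] ++ pairs (iota 0 5))) [::].
Proof. by vm_cast_no_check (erefl true). Qed.

(* A clique [0, ..., 4] with four outer vertices; 6 has a neighbour 3 that is not one of
   the neighbours 0, 1, 2 of 5. *)
Lemma triple_search5 :
  search 8 8 [:: 6] predT 5 [:: (6, 3); (7, 3); (8, 3)] (allpairs pair [:: 8; 7; 6] (iota 0 5))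
    (adj_of ((6, 3) :: [seq (5, j) | j <- iota 0 3] ++ pairs (iota 0 5))) [::].
Proof. by vm_cast_no_check (erefl true). Qed.

(* In the bipartite searches, [0, ..., 6] is the side [X] and [7 + i] is the [i]-th vertex
   of [Y]. *)
Definition alternating_edges k := flatten [seq [:: (7 + i, i); (8 + i, i)] | i <- iota 0 k].

(** [alternating_edges k.-1] is a path through [k] vertices of [Y], and one further vertex of [Y] is
    available. The path found need not extend the given one, as long as it starts in [Y]. *)
Lemma alternating_search :
  all (fun k => search k.*2 k.*2 (iota 7 k.+1) predT 7 [seq (7 + i, 4) | i <- iota 0 k.+1]
                  (allpairs pair (rev (iota 7 k.+1)) (iota 0 7))
                  (adj_of (alternating_edges k.-1)) [::]) (iota 1 3).
Proof. by vm_cast_no_check (erefl true). Qed.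

(* Both ends of the path have neighbours off it; the two cases are whether or not these
   can be taken distinct. *)
Lemma alternating_search4 :
  search 8 8 [:: 11] predT 7 [seq (7 + i, 4) | i <- iota 0 5]
    (allpairs pair [:: 10; 11; 9; 8; 7] (iota 0 7))
    (adj_of [:: (11, 3), (7, 4) & alternating_edges 3]) [::].
Proof. by vm_cast_no_check (erefl true). Qed.

Lemma alternating_search4_closed :
  search 8 8 [:: 11] predT 7 [seq (7 + i, 4) | i <- iota 0 5] (allpairs pair [:: 11] (iota 0 7))
    (adj_of [:: (11, 3), (7, 3) & alternating_edges 3]) [::].
Proof. by vm_cast_no_check (erefl true). Qed.

Ltac distinct := rewrite /= ?(in_cons, in_nil, orbF) ?negb_or;
  repeat (apply/andP; split); first [done | by rewrite eq_sym | idtac].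

(** * Degrees, cores and edge counts *)

Section Graph.
Variables (T : finType) (e : rel T).
Hypotheses (eC : symmetric e) (eI : irreflexive e).
Implicit Types (A B C D K S U V Z : {set T}) (p q s : seq T).

Definition deg S v := #|[set w in S | e v w]|.
(* Twice the number of edges inside [S]. *)
Definition arcs S := \sum_(v in S) deg S v.
Definition closed_in V S := [forall x in S, forall y in V, e x y ==> (y \in S)].
Definition P9_free := forall p, uniq p -> sorted e p -> size p <= 8.

Lemma closed_inP V S :
  reflect {in S & V, forall x y, e x y -> y \in S} (closed_in V S).
Proof.
apply: (iffP forall_inP) => [clS x y xS yV exy|clS x xS].
  by move/(_ x xS)/forall_inP/(_ y yV)/implyP: clS; apply.
by apply/forall_inP => y yV; apply/implyP; apply: clS.
Qed.

Lemma deg_count S s v : uniq s -> s =i S -> count (e v) s = deg S v.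
Proof.
move=> us sS; rewrite /deg -size_filter -(card_uniqP (filter_uniq _ us)).
by apply: eq_card => w; rewrite mem_filter !inE sS andbC.
Qed.

Lemma deg_sub S U v : S \subset U -> deg S v <= deg U v.
Proof.
move=> /subsetP sSU; apply: subset_leq_card; apply/subsetP => w.
by rewrite !inE => /andP[/sSU-> ->].
Qed.

Lemma deg_closed U S v : S \subset U -> closed_in U S -> v \in S -> deg U v = deg S v.
Proof.
move=> /subsetP sSU /closed_inP clS vS; apply: eq_card => w; rewrite !inE.
apply/andP/andP => -[wS evw]; split=> //; last exact: sSU.
exact: clS evw.
Qed.

Lemma deg_lt_card S v : v \in S -> deg S v < #|S|.
Proof.
move=> vS; rewrite [X in _ < X](cardsD1 v) vS ltnS; apply: subset_leq_card.
apply/subsetP => w; rewrite !inE => /andP[-> evw]; rewrite andbT.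
by apply: contraTneq evw => ->; rewrite eI.
Qed.

Lemma degU A B v : [disjoint A & B] -> deg (A :|: B) v = deg A v + deg B v.
Proof.
move=> dAB; rewrite /deg -cardsUI [X in _ + X](_ : _ = 0) ?addn0.
  by apply: eq_card => w; rewrite !inE andb_orl.
apply/eqP; rewrite cards_eq0 -subset0; apply/subsetP => w; rewrite !inE.
by case/andP=> /andP[wA _] /andP[wB _]; rewrite (disjointFr dAB wA) in wB.
Qed.

Lemma sum_degC A B : \sum_(v in A) deg B v = \sum_(v in B) deg A v.
Proof.
have degE S v : deg S v = \sum_(w in S) e v w.
  rewrite /deg -sum1_card big_mkcond [RHS]big_mkcond; apply: eq_bigr => w _.
  by rewrite inE; case: (w \in S); case: (e v w).
under eq_bigr do rewrite degE; rewrite exchange_big.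
by apply: eq_bigr => v _; rewrite degE; apply: eq_bigr => w _; rewrite eC.
Qed.

Lemma arcsU A B : [disjoint A & B] ->
  arcs (A :|: B) = arcs A + arcs B + 2 * \sum_(v in A) deg B v.
Proof.
move=> dAB; rewrite /arcs (big_setID A) /= setIUl setIid.
have -> : B :&: A = set0 by apply/eqP; rewrite setI_eq0 disjoint_sym.
have -> : (A :|: B) :\: A = B.
  by rewrite setDUl setDv set0U; apply/setDidPl; rewrite disjoint_sym.
rewrite setU0; under eq_bigr do rewrite degU //.
under [X in _ + X]eq_bigr do rewrite degU //.
by rewrite !big_split /= (sum_degC B A); lia.
Qed.

Lemma arcs1 v : arcs [set v] = 0.
Proof.
rewrite /arcs big_set1; apply/eqP; rewrite cards_eq0 -subset0.
by apply/subsetP => w; rewrite !inE => /andP[/eqP->]; rewrite eI.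
Qed.

Lemma arcs_D1 S v : v \in S -> arcs S = arcs (S :\ v) + 2 * deg S v.
Proof.
move=> vS; rewrite -{1 3}(setD1K vS) arcsU ?degU ?disjoints1 ?setD11 // arcs1 big_set1.
have -> : deg [set v] v = 0 by have := arcs1 v; rewrite /arcs big_set1.
lia.
Qed.

Lemma arcs_le S : arcs S <= #|S| * #|S|.-1.
Proof.
rewrite -sum_nat_const; apply: leq_sum => v vS.
by have := deg_lt_card vS; case: #|S|.
Qed.

Lemma arcs_closed V S : S \subset V -> closed_in V S ->
  arcs V = arcs S + arcs (V :\: S).
Proof.
move=> sSV /closed_inP clS; rewrite -{1}(setID V S) (setIidPr sSV) arcsU.
  rewrite big1 ?muln0 ?addn0 // => v vS; apply/eqP; rewrite cards_eq0 -subset0.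
  apply/subsetP => w; rewrite !inE => /andP[/andP[wS wV] evw].
  by rewrite (clS _ _ vS wV evw) in wS.
by rewrite -setI_eq0; apply/eqP/setP => w; rewrite !inE; case: (w \in S).
Qed.

(** * Longest paths and Hamilton-connected sets *)

Lemma longer_path p x y : uniq p -> sorted e p -> 5 <= size p <= 8 ->
    4 <= count (e (head x p)) p -> 4 <= count (e (last x p)) p ->
    x \in p -> y \notin p -> e x y ->
  exists q, [/\ uniq q, sorted e q, size p < size q & {subset q <= y :: p}].
Proof.
move=> up /(sortedP x) pp szp d0 d1 xp yp exy; set k := size p in szp *.
have kE : size (p ++ [:: y]) = k.+1 by rewrite size_cat addn1.
have ltix : index x p < k by rewrite index_mem.
have nthp i : i < k -> nth x (p ++ [:: y]) i = nth x p i by move=> ltik; rewrite nth_cat ltik.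
(* The vertices of [p] are numbered along the path, and [y] gets the number [k]. *)
have /allP/(_ k) := longer_search_true; rewrite mem_iota => /(_ szp)/allP/(_ (index x p)).
rewrite mem_iota => /(_ ltix); case/(@search_sound _ e x p [:: y]) => //.
- by rewrite cat_uniq up /= orbF yp.
- by case/andP: szp; case: (k).
- rewrite /= kE ltnS (ltnW ltix) ltnSn nthp // nth_index // nth_cat ltnn subnn exy /=.
  apply/allP => -[i j] /mapP[i']; rewrite mem_iota => /andP[_ lti] [-> ->] /=.
  have lti' : i'.+1 < k by lia.
  by apply/and3P; split; [lia | lia | rewrite !nthp ?pp // ltnW].
- rewrite /= kE !nthp ?nth0 ?(nth_last x p) ?d0 ?d1; lia.
move=> s [q [ss _ szq subq /andP[uq pq]]].
exists (map (nth x (p ++ [:: y])) (s :: q)); split=> //; first by rewrite size_map.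
by move=> z /subq; rewrite mem_cat orbC !inE.
Qed.

Lemma mem_cat_enumD p S : {subset p <= S} -> p ++ enum (S :\: [set x in p]) =i S.
Proof.
move=> pS x; rewrite mem_cat mem_enum !inE.
by case: (boolP (x \in p)) => // /pS->.
Qed.

Lemma uniq_cat_enumD p S : uniq p -> uniq (p ++ enum (S :\: [set x in p])).
Proof.
move=> up; rewrite cat_uniq up enum_uniq andbT /=; apply/hasPn => x.
by rewrite mem_enum !inE => /andP[].
Qed.

Lemma size_cat_enumD p S : uniq p -> {subset p <= S} ->
  size (p ++ enum (S :\: [set x in p])) = #|S|.
Proof.
move=> up pS; rewrite -(card_uniqP (uniq_cat_enumD S up)).
by apply: eq_card => x; rewrite mem_cat_enumD.
Qed.

Lemma search_sound_set C x vs lo i es todo : uniq vs -> vs =i C -> 0 < lo ->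
    {in C, forall v, 4 <= deg C v} ->
    all (fun c : nat * nat => [&& c.1 < #|C|, c.2 < #|C| & e (nth x vs c.1) (nth x vs c.2)]) es ->
    search lo #|C| [:: 0] (eqn^~ i) #|C| [seq (j, 4) | j <- iota 0 #|C|] todo (adj_of es) [::] ->
  exists p, [/\ path e (nth x vs 0) p, uniq (nth x vs 0 :: p),
    last (nth x vs 0) p = nth x vs i, {subset nth x vs 0 :: p <= C} & lo <= size p].
Proof.
move=> uvs vsC lo0 degC ges.
have szvs : size vs = #|C| by rewrite -(card_uniqP uvs); apply: eq_card.
have := @search_sound _ e x vs [::] lo #|C| [:: 0] (eqn^~ i)
  [seq (j, 4) | j <- iota 0 #|C|] es todo eC eI.
rewrite cats0 szvs => /(_ uvs lo0 ges) sound /sound[|s [p []]].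
  apply/allP => c /mapP[j]; rewrite mem_iota => /andP[_ ltj] ->.
  by rewrite /= ltj (deg_count _ uvs vsC) degC // -vsC mem_nth ?szvs.
rewrite inE => /eqP-> /eqnP fp szp subp /andP[up pp].
exists (map (nth x vs) p); split; rewrite ?size_map ?last_map ?fp //.
by move=> z /subp; rewrite vsC.
Qed.

(** A path from [x] to [y] inside [C] that misses a vertex of [C] can be lengthened with the same
    ends, by [link_search]; [link2_search] supplies the first path. A path with [#|C|] vertices
    exhausts [C]. *)
Lemma ham_connected C x y : 5 <= #|C| <= 7 ->
    {in C, forall v, 4 <= deg C v} -> x \in C -> y \in C -> x != y ->
  exists p, [/\ path e x p, uniq (x :: p), last x p = y & x :: p =i C].
Proof.
move=> szC degC xC yC xy.
pose is_link p := [/\ path e x p, uniq (x :: p), last x p = y & {subset x :: p <= C}].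
suff link k : 2 <= k <= #|C| -> exists2 p, is_link p & k <= size (x :: p).
  have [|p [pp up lp pC] szp] := link #|C|; first by lia.
  exists p; split=> //.
  have eq_sz : size (x :: p) = #|[set z in x :: p]| by rewrite cardsE (card_uniqP up).
  have /eqP/setP eqC : [set z in x :: p] == C.
    rewrite eqEcard -eq_sz szp andbT; apply/subsetP => z; rewrite inE.
    exact: pC.
  by move=> z; rewrite -eqC inE.
elim: k => // k IHk /andP[]; rewrite ltnS leq_eqVlt => /predU1P[<- _|k_gt1 ltkC].
  have xyC : {subset [:: x; y] <= C} by move=> z; rewrite !inE => /pred2P[]->.
  have uxy : uniq [:: x; y] by rewrite /= inE xy.
  have /allP/(_ #|C|) := link2_search_true; rewrite mem_iota => /(_ szC).
  have uvs := uniq_cat_enumD C uxy.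
  case/(search_sound_set (x := x) uvs (mem_cat_enumD xyC))=> // p [] *.
  by exists p.
have [p [pp up lp pC]] := IHk (introT andP (conj k_gt1 (ltnW ltkC))).
rewrite leq_eqVlt => /predU1P[szk|]; last by exists p.
set vs := (x :: p) ++ enum (C :\: [set z in x :: p]).
have nthp i : i < k -> nth x vs i = nth x (x :: p) i.
  by move=> ltik; rewrite nth_cat -szk ltik.
have /allP/(_ #|C|) := link_search_true; rewrite mem_iota => /(_ szC)/allP/(_ k).
have -> : k \in iota 2 (#|C| - 2) by rewrite mem_iota; lia.
have uvs : uniq vs by exact: uniq_cat_enumD.
move=> /(_ isT); case/(search_sound_set (x := x) uvs (mem_cat_enumD pC)) => //; first by lia.
  apply/allP => ij /mapP[i]; rewrite mem_iota => /andP[_ lti] ->.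
  rewrite -[X in X && _]/(i < #|C|) -[X in _ && (X && _)]/(i.+1 < #|C|).
  have lti' : i.+1 < k by lia.
  apply/and3P; split; [lia | lia | rewrite !nthp ?(ltnW lti') //].
  have /(sortedP x) := (pp : sorted e (x :: p)); apply.
  by rewrite -szk.
have -> : nth x vs k.-1 = y by rewrite nthp; [rewrite szk (nth_last x (x :: p)) | lia].
by move=> q [] *; exists q.
Qed.

Lemma rev_sorted_sym s : sorted e (rev s) = sorted e s.
Proof. by rewrite rev_sorted; apply: eq_sorted => x y; rewrite eC. Qed.

Lemma head_rev x s : head x (rev s) = last x s.
Proof. by case/lastP: s => // s y; rewrite rev_rcons last_rcons. Qed.

(** The ends of a longest path in [U] have all their neighbours in [U] on it, so [longer_path]
    forbids an edge from the path to the rest of [U]. If the path has 8 vertices, an edge to any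
    other vertex of the graph would likewise give a [P_9]. *)
Lemma core_component U : P9_free -> U != set0 -> {in U, forall v, 4 <= deg U v} ->
  exists C, [/\ C \subset U, closed_in U C, 5 <= #|C| <= 8 &
                #|C| = 8 -> closed_in setT C].
Proof.
move=> free /set0Pn[u uU] degU4.
pose has_path k := [exists t : k.-tuple T, [&& uniq t, sorted e t & all [in U] t]].
have has_path1 : exists k, has_path k.
  by exists 1; apply/existsP; exists [tuple u]; rewrite /= uU.
have has_path8 k : has_path k -> k <= 8.
  by case/existsP=> t /and3P[ut pt _]; rewrite -(size_tuple t) free.
case: (ex_maxnP has_path1 has_path8) => k /existsP[t /and3P[ut pt /allP tU]] maxk.
have szt := size_tuple t; set p : seq T := t in szt ut pt tU.
have max_p q : uniq q -> sorted e q -> {subset q <= U} -> size q <= size p.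
  move=> uq pq qU; rewrite szt; apply: maxk; apply/existsP; exists (in_tuple q).
  by rewrite /= uq pq; apply/allP.
have head_deg q : uniq q -> sorted e q -> {subset q <= U} -> size q = size p ->
    4 <= count (e (head u q)) q.
  case: q => [|x q] uq pq qU szq.
    (* The empty path is not a longest one, since [u] alone is longer. *)
    have := @max_p [:: u] isT isT; rewrite -szq => le10; suff: 1 <= 0 by [].
    by apply: le10 => z; rewrite mem_seq1 => /eqP->.
  apply: leq_trans (degU4 x (qU _ (mem_head _ _))) _.
  rewrite -size_filter -(card_uniqP (filter_uniq _ uq)); apply: subset_leq_card.
  apply/subsetP => w; rewrite !inE mem_filter => /andP[wU exw]; rewrite exw /=.
  apply: contraT => wq; have := @max_p [:: w, x & q]; rewrite -szq ltnn => -> //.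
  - by rewrite cons_uniq wq.
  - by rewrite /= eC exw.
  - by move=> z; rewrite inE => /predU1P[->|/qU].
have d0 := head_deg p ut pt tU (erefl _).
have d1 : 4 <= count (e (last u p)) p.
  rewrite -head_rev -count_rev; apply: head_deg; rewrite ?rev_uniq ?rev_sorted_sym ?size_rev //.
  by move=> z; rewrite mem_rev; apply: tU.
have szp : 5 <= size p <= 8.
  rewrite free // andbT; case: (p) d0 => //= x q; rewrite eI add0n => d0.
  by rewrite ltnS (leq_trans d0 (count_size _ _)).
have grow x y : x \in p -> y \notin p -> e x y ->
  exists q, [/\ uniq q, sorted e q, size p < size q & {subset q <= y :: p}].
- move=> xp yp exy; apply: (@longer_path p x y) => //.
    by case: (p) xp d0.
  by case: (p) xp d1.
have szC : #|[set z in p]| = size p by rewrite cardsE (card_uniqP ut).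
exists [set z in p]; split; rewrite ?szC //.
- by apply/subsetP => z; rewrite inE => /tU.
- apply/closed_inP => x y; rewrite !inE => xp yU exy; apply: contraT => yp.
  have [q [uq pq ltpq qp]] := grow x y xp yp exy.
  have := max_p q uq pq; rewrite leqNgt ltpq; apply=> z /qp.
  by rewrite inE => /predU1P[->|/tU].
move=> p8; apply/closed_inP => x y; rewrite !inE => xp _ exy; apply: contraT => yp.
have [q [uq pq ltpq _]] := grow x y xp yp exy.
by have := free q uq pq; rewrite leqNgt -p8 ltpq.
Qed.

(** * Cores and 3-degenerate sets *)

Lemma core_exists V : exists K, [/\ K \subset V, {in K, forall v, 4 <= deg K v} &
  forall S, K \proper S -> S \subset V -> exists2 v, v \in S :\: K & deg S v <= 3].
Proof.
pose P K := (K \subset V) && [forall v in K, 4 <= deg K v].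
have P0 : P set0.
  by rewrite /P sub0set; apply/forall_inP => v; rewrite inE.
(* [K] is maximal for inclusion. A larger [S] fails the degree condition, and it does so outside
   [K], because vertices of [K] keep their four neighbours. *)
have [K /maxsetP[/andP[sKV /forall_inP degK] maxK] _] := maxset_exists P0.
exists K; split=> // S /andP[sKS nsSK] sSV.
have : ~~ P S by apply: contra nsSK => PS; rewrite (maxK S PS sKS).
rewrite /P sSV /= negb_forall_in => /exists_inP[v vS]; rewrite -ltnNge => degv.
exists v => //; rewrite inE vS andbT; apply: contraL degv => vK.
by rewrite -leqNgt (leq_trans (degK v vK)) // deg_sub.
Qed.

Definition degenerate Z := forall S, S \subset Z -> S != set0 -> exists2 v, v \in S & deg S v <= 3.

Lemma degenerate_sub Z Z' : Z' \subset Z -> degenerate Z -> degenerate Z'.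
Proof. by move=> sZ dZ S /subset_trans/(_ sZ); apply: dZ. Qed.

(** Each vertex peeled off takes at most 6 arcs with it, and the last one takes none. In edges the
    bound is 3n - 3. *)
Lemma degenerate_arcs Z : degenerate Z -> 0 < #|Z| -> arcs Z + 6 <= 6 * #|Z|.
Proof.
have [m] := ubnP #|Z|; elim: m Z => // m IHm Z leZm dZ Z0.
have [|v vZ dv] := dZ Z (subxx _); first by rewrite -card_gt0.
have := cardsD1 v Z; rewrite vZ (arcs_D1 vZ) => cardZ.
have [Zv0|Zv_gt0] := posnP #|Z :\ v|.
  have := arcs_le (Z :\ v); have := deg_lt_card vZ; lia.
have := IHm (Z :\ v) _ (degenerate_sub (subsetDl _ _) dZ) Zv_gt0; lia.
Qed.

(** Stopping the peeling at three vertices, which span at most 6 arcs, improves the bound to 3n - 6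
    edges. *)
Lemma degenerate_arcs3 Z : degenerate Z -> 3 <= #|Z| -> arcs Z + 12 <= 6 * #|Z|.
Proof.
have [m] := ubnP #|Z|; elim: m Z => // m IHm Z leZm dZ Z3.
have [|v vZ dv] := dZ Z (subxx _); first by rewrite -card_gt0; lia.
have [Z3'|Z4] := leqP #|Z| 3.
  have := arcs_le Z; have -> : #|Z| = 3 by lia.
  by rewrite -(leq_add2r 12).
have := cardsD1 v Z; rewrite vZ (arcs_D1 vZ) => cardZ.
have := IHm (Z :\ v) _ (degenerate_sub (subsetDl _ _) dZ); lia.
Qed.

Lemma core_degenerate V K : K \subset V ->
    (forall S, K \proper S -> S \subset V -> exists2 v, v \in S :\: K & deg S v <= 3) ->
  degenerate (V :\: K).
Proof.
move=> sKV coreK S sS /set0Pn[u uS]; have sSV := subset_trans sS (subsetDl _ _).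
have [||v] := coreK (K :|: S).
- rewrite properUl //; apply/negP => /subsetP/(_ u uS) uK.
  by have := subsetP sS u uS; rewrite inE uK.
- by rewrite subUset sKV.
rewrite !inE => /andP[/negPf-> /= vS] dv; exists v => //.
by apply: leq_trans dv; apply: deg_sub; apply: subsetUr.
Qed.

(** The vertices of [S] outside [K] are peeled off one at a time, each taking at most 6 arcs. *)
Lemma core_arcs V K S : K \subset S -> S \subset V ->
    (forall S, K \proper S -> S \subset V -> exists2 v, v \in S :\: K & deg S v <= 3) ->
  arcs S <= arcs K + 6 * #|S :\: K|.
Proof.
move=> sKS sSV coreK; have [m] := ubnP #|S :\: K|.
elim: m S sKS sSV => // m IHm S sKS sSV leSm.
have [->|neqKS] := eqVneq K S; first exact: leq_addr.
have [||v vSK dv] := coreK S => //; first by rewrite properEneq neqKS.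
have vS : v \in S by case/setDP: vSK.
have eqD : (S :\ v) :\: K = (S :\: K) :\ v by rewrite !setDDl setUC.
have := cardsD1 v (S :\: K); rewrite vSK => cardSK.
have := IHm (S :\ v); rewrite eqD (arcs_D1 vS) => IH.
have sKSv : K \subset S :\ v.
  by apply/subsetD1P; split=> //; case/setDP: vSK.
have := IH sKSv (subset_trans (subsetDl _ _) sSV); lia.
Qed.

(** Closed sets are unions of components. The sizes 7 and 8 are singled out because [K_7] and [K_8]
    exceed 3n - 3 edges, while [K_5] and [K_6] do not. *)
Definition no_closed78 V :=
  forall S, S \subset V -> closed_in V S -> #|S| <> 7 /\ #|S| <> 8.

Lemma no_closed78D V D : D \subset V -> closed_in V D -> no_closed78 V -> no_closed78 (V :\: D).
Proof.
move=> /subsetP sDV /closed_inP clD no78 S sS /closed_inP clS; apply: no78.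
  exact: subset_trans sS (subsetDl _ _).
apply/closed_inP => x y xS yV exy; apply: (clS x) => //; rewrite inE yV andbT.
have := subsetP sS x xS; rewrite inE => /andP[xD xV].
by apply: contra xD => yD; apply: clD yD xV _; rewrite eC.
Qed.

Lemma closed_inD V C : C \subset V -> closed_in V C -> closed_in V (V :\: C).
Proof.
move=> /subsetP sCV /closed_inP clC; apply/closed_inP => x y /setDP[xV xC] yV exy.
by rewrite inE yV andbT; apply: contra xC => yC; apply: clC yC xV _; rewrite eC.
Qed.

Lemma closed_in_sub V V' C : V \subset V' -> closed_in V' C -> closed_in V C.
Proof.
move=> /subsetP sVV' /closed_inP clC; apply/closed_inP => x y xC yV.
by apply: clC; rewrite ?sVV'.
Qed.

(** Components are split off one at a time. One with 5 or 6 vertices has at most 3n - 3 edges even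
    when complete, and with two or more of them the total drops to 3n - 6. *)
Lemma core_bound U : P9_free -> U != set0 -> {in U, forall v, 4 <= deg U v} ->
    (forall C, C \subset U -> #|C| = 8 -> ~~ closed_in setT C) ->
  [\/ exists C, [/\ C \subset U, #|C| = 7 & {in C, forall v, 4 <= deg C v}],
      arcs U + 12 <= 6 * #|U| |
      5 <= #|U| <= 6 /\ arcs U + 6 <= 6 * #|U|].
Proof.
move=> free; have [m] := ubnP #|U|; elim: m U => // m IHm U leUm U0 d4 no8.
have [C [sCU clC szC C8]] := core_component free U0 d4.
have d4C : {in C, forall v, 4 <= deg C v}.
  by move=> v vC; rewrite -(deg_closed sCU clC vC) d4 // (subsetP sCU).
have [C7|C7] := eqVneq #|C| 7; first by constructor 1; exists C.
have {C7 C8}szC : 5 <= #|C| <= 6.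
  have /eqP : #|C| != 8 by apply/eqP => C8'; have := no8 C sCU C8'; rewrite C8.
  by lia.
have arcsC : arcs C + 6 <= 6 * #|C|.
  have := arcs_le C; case/andP: szC; rewrite leq_eqVlt => /predU1P[<-|]; first lia.
  by move=> C5 C6; rewrite (_ : #|C| = 6); lia.
have [eqUC|UC0] := eqVneq (U :\: C) set0.
  have -> : U = C by apply/eqP; rewrite eqEsubset sCU -setD_eq0 eqUC eqxx.
  by constructor 3.
have := cardsD U C; rewrite (setIidPr sCU) => cardUC.
have leCU := subset_leq_card sCU; have sDU := subsetDl U C.
have d4D : {in U :\: C, forall v, 4 <= deg (U :\: C) v}.
  move=> v vUC; rewrite -(deg_closed sDU (closed_inD sCU clC) vUC) d4 //.
  by case/setDP: vUC.
have ltD : #|U :\: C| < m by lia.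
have [|[C' [sC' C'7 dC']]|bdD|[_ bdD]] := IHm (U :\: C) ltD UC0 d4D.
- by move=> C' /subset_trans/(_ sDU); apply: no8.
- by constructor 1; exists C'; split=> //; apply: subset_trans sC' sDU.
- by constructor 2; rewrite (arcs_closed sCU clC); lia.
by constructor 2; rewrite (arcs_closed sCU clC); lia.
Qed.

Lemma sorted_catrev w s t : path e w s -> path e w t -> sorted e (catrev s (w :: t)).
Proof.
elim: s w t => //= u s IHs w t /andP[ewu us] wt.
by apply: (IHs u (w :: t)) => //=; rewrite eC ewu.
Qed.

(** A Hamiltonian path of [C] ending in [x] continues through [w :: s]. *)
Lemma attach1 C x w s : P9_free -> 5 <= #|C| <= 7 -> {in C, forall v, 4 <= deg C v} ->
    x \in C -> e x w -> path e w s -> uniq (w :: s) ->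
    all (fun z => z \notin C) (w :: s) ->
  #|C| + size (w :: s) <= 8.
Proof.
move=> free szC d4 xC exw ws us sC.
have [y yC yx] : exists2 y, y \in C & y != x.
  have /card_gt0P[y] : 0 < #|C :\ x| by have := cardsD1 x C; rewrite xC; lia.
  by rewrite !inE => /andP[yx yC]; exists y.
have [p [pp up lp pC]] := ham_connected szC d4 yC xC yx.
have szp : size (y :: p) = #|C| by rewrite -(card_uniqP up); apply: eq_card.
rewrite -szp -size_cat; apply: free.
  rewrite cat_uniq up us andbT andTb; apply/hasPn => z zs; rewrite /= pC.
  by have /allP := sC; apply.
by rewrite /= cat_path pp lp /= exw.
Qed.

(** A Hamiltonian path of [C] from [x] to [x'] is prolonged at both ends. *)
Lemma attach2 C x x' w w' s s' : P9_free -> 5 <= #|C| <= 7 ->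
    {in C, forall v, 4 <= deg C v} -> x \in C -> x' \in C -> x != x' ->
    e w x -> e w' x' -> path e w s -> path e w' s' ->
    uniq ((w :: s) ++ (w' :: s')) ->
    all (fun z => z \notin C) ((w :: s) ++ (w' :: s')) ->
  #|C| + (size (w :: s) + size (w' :: s')) <= 8.
Proof.
move=> free szC d4 xC x'C xx' ewx ewx' ws ws' us sC.
have [p [pp up lp pC]] := ham_connected szC d4 xC x'C xx'.
have szp : size (x :: p) = #|C| by rewrite -(card_uniqP up); apply: eq_card.
pose q := catrev s ([:: w] ++ (x :: p) ++ (w' :: s')).
have perm_q : perm_eq q ((x :: p) ++ ((w :: s) ++ (w' :: s'))).
  rewrite -[w :: s]cat1s; apply/permP => a; rewrite /q catrevE !count_cat count_rev; lia.
have szq : size q = #|C| + (size (w :: s) + size (w' :: s')).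
  by rewrite (perm_size perm_q) size_cat szp size_cat.
rewrite -szq; apply: free.
  rewrite (perm_uniq perm_q) cat_uniq up us andbT andTb; apply/hasPn => z zs.
  by rewrite /= pC; have /allP := sC; apply.
apply: sorted_catrev => //.
by rewrite /= ewx cat_path pp lp /= eC ewx'.
Qed.

Lemma deg_witness C v : 0 < deg C v -> exists2 x, x \in C & e v x.
Proof. by case/card_gt0P=> x; rewrite inE => /andP[]; exists x. Qed.

Lemma deg_other C v y : 1 < deg C v -> exists x, [/\ x \in C, e v x & x != y].
Proof.
rewrite /deg (cardsD1 y) => dv.
have /card_gt0P[x] : 0 < #|[set w in C | e v w] :\ y|.
  by move: dv; case: (y \in _) => /=; lia.
by rewrite !inE => /and3P[xy xC evx]; exists x.
Qed.

(** [D] is [C] with the set [W] of vertices attached to it. By [attach1] a vertex of [W] has no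
    neighbour outside [C], so [D] is closed and [W] has at least 2 vertices, the sizes 7 and 8 being
    excluded. By [attach2] each vertex of [W] then has one neighbour only, and [D] has at most 42 +
    2|W| arcs. *)
Lemma pendant7 V C : P9_free -> no_closed78 V -> C \subset V -> #|C| = 7 ->
    {in C, forall v, 4 <= deg C v} ->
  exists D, [/\ D \subset V, closed_in V D, 9 <= #|D| & arcs D <= 28 + 2 * #|D|].
Proof.
move=> free no78 sCV C7 d4.
have szC : 5 <= #|C| <= 7 by rewrite C7.
pose W := [set w in V :\: C | 0 < deg C w].
have WP w : w \in W -> [/\ w \in V, w \notin C & exists2 x, x \in C & e w x].
  by rewrite !inE => /andP[/andP[wC wV] /deg_witness]; split.
have W_out w y : w \in W -> y \notin C -> e w y -> False.
  move=> /WP[_ wC [x xC ewx]] yC ewy.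
  have wy : w != y by apply: contraTneq ewy => ->; rewrite eI.
  have := @attach1 C x w [:: y] free szC d4 xC; rewrite C7 eC ewx /= ewy inE wy wC yC.
  by move=> /(_ isT isT isT isT).
have dCW : [disjoint C & W].
  by rewrite -setI_eq0; apply/eqP/setP => z; rewrite !inE; case: (z \in C).
have sDV : C :|: W \subset V.
  by rewrite subUset sCV; apply/subsetP => w /WP[].
have clD : closed_in V (C :|: W).
  apply/closed_inP => x y /setUP[xC|xW] yV exy; rewrite inE; case: (boolP (y \in C)) => //= yC.
    rewrite !inE yC yV /=; apply/card_gt0P; exists x; by rewrite inE xC eC.
  by case: (W_out x y).
have cardD : #|C :|: W| = 7 + #|W|.
  by rewrite cardsU (disjoint_setI0 dCW) cards0 subn0 C7.
have [D7 D8] := no78 _ sDV clD.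
exists (C :|: W); split=> //; first by lia.
have W2 : 2 <= #|W| by lia.
have arcsW : arcs W = 0.
  apply: big1 => v vW; apply/eqP; rewrite cards_eq0 -subset0; apply/subsetP => w.
  rewrite !inE => /andP[/andP[/andP[wC _] _] evw]; by case: (W_out v w).
have degW v : v \in W -> deg C v <= 1.
  move=> vW; rewrite leqNgt; apply/negP => dv.
  have [_ vC _] := WP v vW.
  have /card_gt0P[w] : 0 < #|W :\ v| by have := cardsD1 v W; rewrite vW; lia.
  rewrite in_setD1 => /andP[wv /WP[_ wC [y yC ewy]]].
  have [x [xC evx xy]] := deg_other y dv.
  have := @attach2 C x y v w [::] [::] free szC d4 xC yC xy evx ewy isT isT.
  by rewrite /= inE eq_sym wv vC wC C7; move=> /(_ isT isT).
rewrite arcsU // arcsW sum_degC; have := arcs_le C; rewrite C7 cardD.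
have : \sum_(v in W) deg C v <= #|W| * 1 by rewrite -sum_nat_const; apply: leq_sum.
lia.
Qed.

(** * Edge bounds for graphs without [P_9] *)

Definition is_core V K := [/\ K \subset V, {in K, forall v, 4 <= deg K v} &
  forall S, K \proper S -> S \subset V -> exists2 v, v \in S :\: K & deg S v <= 3].

Lemma arcs_cases V : P9_free -> no_closed78 V ->
  [\/ exists D, [/\ D \subset V, closed_in V D, 9 <= #|D| & arcs D <= 28 + 2 * #|D|],
      degenerate V |
      exists2 K, is_core V K & arcs K + 12 <= 6 * #|K| \/
        5 <= #|K| <= 6 /\ arcs K + 6 <= 6 * #|K|].
Proof.
move=> free no78; have [K coreK] := core_exists V; case: (coreK) => sKV d4 degK.
have [K0|K0] := eqVneq K set0.
  by constructor 2; have := core_degenerate sKV degK; rewrite K0 setD0.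
have [|[C [sCK C7 d4C]]|bdK|bdK] := core_bound free K0 d4.
- move=> C sCK C8; apply/negP => /(closed_in_sub (subsetT V)) clC.
  by case: (no78 C (subset_trans sCK sKV) clC).
- by constructor 1; apply: pendant7 C7 d4C => //; apply: subset_trans sCK sKV.
- by constructor 3; exists K => //; left.
by constructor 3; exists K => //; right.
Qed.

(** The set [D] of [pendant7] satisfies the bound with room to spare, as 28 + 2|D| + 6 <= 6|D| from
    |D| = 9 on. It is split off, and the induction treats the rest. *)
Lemma arcs_bound V : P9_free -> no_closed78 V -> 0 < #|V| -> arcs V + 6 <= 6 * #|V|.
Proof.
move=> free; have [m] := ubnP #|V|; elim: m V => // m IHm V leVm no78 V0.
have [[D [sDV clD D9 arcsD]]|dV|[K [sKV _ coreK] arcsK]] := arcs_cases free no78.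
- rewrite (arcs_closed sDV clD); have := cardsD V D; rewrite (setIidPr sDV).
  have := subset_leq_card sDV => leDV cardVD.
  have [VD0|VD0] := posnP #|V :\: D|; first by have := arcs_le (V :\: D); lia.
  have := IHm (V :\: D) _ (no_closed78D sDV clD no78) VD0; lia.
- exact: degenerate_arcs.
have := core_arcs sKV (subxx V) coreK; have := cardsD V K; rewrite (setIidPr sKV).
have := subset_leq_card sKV; case: arcsK => [|[]]; lia.
Qed.

(** The other cases of [arcs_cases] allow at most 90 arcs on 17 vertices: at most 88 when a set [D]
    splits off, and 6 * 17 - 12 when the graph is degenerate or has a sparser core. *)
Lemma dense_core V : P9_free -> no_closed78 V -> #|V| = 17 -> 92 <= arcs V ->
  exists2 K, is_core V K & 5 <= #|K| <= 6.
Proof.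
move=> free no78 V17 arcsV.
have [[D [sDV clD D9 arcsD]]|dV|[K coreK arcsK]] := arcs_cases free no78.
- move: arcsV; rewrite (arcs_closed sDV clD); have := cardsD V D; rewrite (setIidPr sDV).
  have := subset_leq_card sDV; rewrite V17 => leDV cardVD.
  have [VD0|VD0] := posnP #|V :\: D|; first by have := arcs_le (V :\: D); lia.
  have := arcs_bound free (no_closed78D sDV clD no78) VD0; lia.
- have := degenerate_arcs3 dV; rewrite V17; lia.
exists K => //; case: coreK => sKV _ coreK; case: arcsK => [arcsK|[]//].
have := core_arcs sKV (subxx V) coreK; have := cardsD V K; rewrite (setIidPr sKV).
have := subset_leq_card sKV; lia.
Qed.

Lemma deg_le_size S u s : (forall z, z \in S -> e u z -> z \in s) -> deg S u <= size s.
Proof.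
move=> Ss; apply: leq_trans (card_size s); apply: subset_leq_card.
by apply/subsetP => z; rewrite inE => /andP[]; apply: Ss.
Qed.

(** * Nine-vertex paths around a core with 5 or 6 vertices *)

Lemma search_P9 C (x : T) p q b starts cs es todo : uniq (p ++ q) -> p =i C -> size p = b ->
    all (fun c : nat * nat => [&& c.1 < size (p ++ q), c.2 < size (p ++ q) &
      e (nth x (p ++ q) c.1) (nth x (p ++ q) c.2)]) es ->
    all (fun c : nat * nat => (c.1 < size (p ++ q)) && (c.2 <= deg C (nth x (p ++ q) c.1))) cs ->
    search 8 8 starts predT b cs todo (adj_of es) [::] ->
  ~ P9_free.
Proof.
move=> upq pC <- ges gcs; case/(search_sound (x0 := x) (A := p) (B := q) eC eI) => //.
  apply: sub_all gcs => c; rewrite (deg_count _ _ pC) //.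
  by move: upq; rewrite cat_uniq => /andP[].
move=> s [r [_ _ szr _ /andP[ur pr]]] free.
by have := free _ ur pr; rewrite /= size_map leqNgt ltnS szr.
Qed.

Lemma uniq_cat_out C p q : p =i C -> uniq p -> uniq q -> all (fun z => z \notin C) q ->
  uniq (p ++ q).
Proof.
move=> pC up uq qC; rewrite cat_uniq up uq andbT; apply/hasPn => z zq.
by rewrite /= pC; have /allP := qC; apply.
Qed.

Lemma core6_P9 C w1 w2 w3 : #|C| = 6 -> {in C, forall v, 4 <= deg C v} ->
    uniq [:: w1; w2; w3] -> all (fun z => z \notin C) [:: w1; w2; w3] ->
    3 <= deg C w1 -> 3 <= deg C w2 -> 3 <= deg C w3 -> ~ P9_free.
Proof.
move=> C6 d4 uw wC d1 d2 d3.
have [x xC ew1x] := deg_witness (leq_trans (isT : 0 < 3) d1).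
(* [w1] and [w3] are attached to the two ends of a Hamiltonian path of [C]; in [end_search6] they
   are the vertices 6 and 7, and [w2] is 8. *)
have [y [yC ew2y yx]] := deg_other x (leq_trans (isT : 1 < 3) d3).
have szC : 5 <= #|C| <= 7 by rewrite C6.
have xy : x != y by rewrite eq_sym.
have [p [pp up lp pC]] := ham_connected szC d4 xC yC xy.
have szp : size (x :: p) = 6 by rewrite -C6 -(card_uniqP up); apply: eq_card.
case: p pp up lp pC szp => [|c1 [|c2 [|c3 [|c4 [|c5 [|]]]]]] //= pp up lp pC _.
rewrite -lp in ew2y.
have uq : uniq ([:: x; c1; c2; c3; c4; c5] ++ [:: w1; w3; w2]).
  apply: uniq_cat_out pC up _ _; last by move: wC; rewrite /= => /and4P[-> -> -> _].
  by move: uw; rewrite /= !inE !negb_or (eq_sym w3) => /and3P[/andP[-> ->] -> _].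
apply: (search_P9 (x := x) uq pC (erefl _) _ _ end_search6).
  rewrite /= ew1x (eC c5) ew2y /=.
  by move: pp; rewrite /= => /and5P[-> -> -> -> /andP[-> _]].
have d4p z : z \in [:: x; c1; c2; c3; c4; c5] -> 4 <= deg C z by rewrite pC => /d4.
by rewrite /= d1 d2 d3 !d4p // !inE eqxx ?orbT.
Qed.

Lemma core5_complete C : #|C| = 5 -> {in C, forall v, 4 <= deg C v} ->
  {in C &, forall x y, x != y -> e x y}.
Proof.
move=> C5 d4 x y xC yC xy; apply: contraLR (d4 x xC) => exy; rewrite -ltnNge.
have cardCy : #|C :\ y| = 4 by have := cardsD1 y C; rewrite C5 yC; lia.
have : deg (C :\ y) x < #|C :\ y| by apply: deg_lt_card; rewrite !inE xy.
rewrite cardCy; apply: leq_ltn_trans; apply: subset_leq_card; apply/subsetP => z.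
rewrite !inE => /andP[-> exz]; rewrite exz !andbT.
by apply: contraNneq exy => <-.
Qed.

Lemma three_nbrs C z : 3 <= deg C z -> exists x1 x2 x3,
  [/\ uniq [:: x1; x2; x3], {subset [:: x1; x2; x3] <= C} & {in [:: x1; x2; x3], forall x, e z x}].
Proof.
case/card_gt2P=> x1 [x2 [x3 []]]; rewrite !inE.
case=> /andP[x1C ezx1] /andP[x2C ezx2] /andP[x3C ezx3] [x12 x23 x31].
exists x1, x2, x3; rewrite /= !inE negb_or x12 x23 (eq_sym x1) x31; split=> // x;
  by rewrite !inE => /or3P[] /eqP->.
Qed.

Lemma complete_pairs x C p q i j : {in C &, forall x y, x != y -> e x y} -> p =i C -> uniq p ->
    i < j < size p -> e (nth x (p ++ q) i) (nth x (p ++ q) j).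
Proof.
move=> eCC pC up /andP[ltij ltjp]; have ltip := ltn_trans ltij ltjp.
by rewrite !nth_cat ltip ltjp eCC -?pC ?mem_nth // nth_uniq // neq_ltn ltij.
Qed.

Lemma core5_pendant_P9 C z v w1 w2 : #|C| = 5 -> {in C, forall v, 4 <= deg C v} ->
    uniq [:: z; w1; w2; v] -> all (fun z => z \notin C) [:: z; w1; w2; v] ->
    e z v -> 3 <= deg C z -> 3 <= deg C w1 -> 3 <= deg C w2 -> ~ P9_free.
Proof.
move=> C5 d4 uw wC ezv dz d1 d2; have eCC := core5_complete C5 d4.
have [x1 [x2 [x3 [ux xC ezx]]]] := three_nbrs dz.
have := size_cat_enumD ux xC; rewrite C5.
have := mem_cat_enumD xC; have := uniq_cat_enumD C ux.
case: (enum _) => [|y [|y' []]] // up pC _.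
have uq := uniq_cat_out pC up uw wC.
apply: (search_P9 (x := z) uq pC (erefl _) _ _ end_search5); last by rewrite /= d1 d2.
have cp (i j : nat) (ij : i < j < 5) := complete_pairs z [:: z; w1; w2; v] eCC pC up ij.
rewrite [all _ _]/= ezv !ezx ?inE ?eqxx ?orbT //=.
by rewrite (cp 0 1) // (cp 0 2) // (cp 0 3) // (cp 0 4) // (cp 1 2) // (cp 1 3) //
  (cp 1 4) // (cp 2 3) // (cp 2 4) // (cp 3 4).
Qed.

(** This forces outer vertices to share their neighbours in [C]: a neighbour of [w2] missed by [w1]
    becomes the vertex 3 of [triple_search5], after three neighbours of [w1]. *)
Lemma core5_triple_P9 C w1 w2 w3 w4 y : #|C| = 5 -> {in C, forall v, 4 <= deg C v} ->
    uniq [:: w1; w2; w3; w4] -> all (fun z => z \notin C) [:: w1; w2; w3; w4] ->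
    3 <= deg C w1 -> 3 <= deg C w2 -> 3 <= deg C w3 -> 3 <= deg C w4 ->
    y \in C -> e w2 y -> ~~ e w1 y -> ~ P9_free.
Proof.
move=> C5 d4 uw wC d1 d2 d3 d5 yC ew2y ew1y; have eCC := core5_complete C5 d4.
have [x1 [x2 [x3 [ux xC ezx]]]] := three_nbrs d1.
have uxy : uniq [:: x1; x2; x3; y].
  rewrite -[[:: _; _; _; _]]/(rcons [:: x1; x2; x3] y) rcons_uniq ux andbT.
  by apply: contra ew1y => /ezx.
have xyC : {subset [:: x1; x2; x3; y] <= C}.
  move=> z; rewrite -[[:: _; _; _; _]]/(rcons [:: x1; x2; x3] y) mem_rcons inE.
  by case/predU1P=> [->//|/xC].
have := size_cat_enumD uxy xyC; rewrite C5.
have := mem_cat_enumD xyC; have := uniq_cat_enumD C uxy.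
case: (enum _) => [|y' []] // up pC _.
have uq := uniq_cat_out pC up uw wC.
apply: (search_P9 (x := y) uq pC (erefl _) _ _ triple_search5); last by rewrite /= d2 d3 d5.
have cp (i j : nat) (ij : i < j < 5) := complete_pairs y [:: w1; w2; w3; w4] eCC pC up ij.
rewrite [all _ _]/= ew2y !ezx ?inE ?eqxx ?orbT //=.
by rewrite (cp 0 1) // (cp 0 2) // (cp 0 3) // (cp 0 4) // (cp 1 2) // (cp 1 3) //
  (cp 1 4) // (cp 2 3) // (cp 2 4) // (cp 3 4).
Qed.

Lemma deg_gt0 S v w : w \in S -> e v w -> 0 < deg S v.
Proof. by move=> wS evw; apply/card_gt0P; exists w; rewrite inE wS. Qed.

Lemma deg_eq0 S v : (forall w, w \in S -> ~~ e v w) -> deg S v = 0.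
Proof. by move=> Sv; apply/eqP; rewrite -leqn0; apply: (deg_le_size (s := [::])) => w /Sv/negP. Qed.

Lemma deg_full S v : {in S, forall w, e v w} -> deg S v = #|S|.
Proof. by move=> Sv; apply: eq_card => w; rewrite inE; apply: andb_idr => /Sv. Qed.

(* So 272 arcs in three colours give some colour 92 rather than just 91. *)
Lemma even_arcs S : ~~ odd (arcs S).
Proof.
have [m] := ubnP #|S|; elim: m S => // m IHm S leSm.
have [->|[v vS]] := set_0Vmem S; first by rewrite /arcs big_set0.
rewrite (arcs_D1 vS) oddD oddM addbF IHm //.
by have := cardsD1 v S; rewrite vS; lia.
Qed.

(** * A small core in a dense graph on 17 vertices *)

Section Core.
Variables V K : {set T}.
Hypotheses (free : P9_free) (V17 : #|V| = 17) (arcsV : 92 <= arcs V).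
Hypotheses (coreK : is_core V K) (szK : 5 <= #|K| <= 6).
Let R := V :\: K.

Let d4 : {in K, forall v, 4 <= deg K v}. Proof. by case: coreK. Qed.
Let sKV : K \subset V. Proof. by case: coreK. Qed.
Let szK7 : 5 <= #|K| <= 7. Proof. by lia. Qed.
Let degR : degenerate R. Proof. by case: coreK => *; apply: core_degenerate. Qed.

Let cardR : #|R| = 17 - #|K|. Proof. by rewrite cardsD (setIidPr sKV) V17. Qed.

Let arcsK : arcs K <= #|K| * (#|K|.-1). Proof. exact: arcs_le. Qed.

Let sRV v : v \in R -> v \in V. Proof. by case/setDP. Qed.
Let sRK v : v \in R -> v \notin K. Proof. by case/setDP. Qed.

Let degV v : deg V v = deg K v + deg R v.
Proof.
rewrite -degU ?setID /R; last first.
  by rewrite -setI_eq0; apply/eqP/setP => z; rewrite !inE; case: (z \in K).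
by rewrite -{1}(setID V K) (setIidPr sKV).
Qed.

(** The vertices outside [K] and [Z] are peeled off at 6 arcs each. Compared with [arcsV], this
    bounds from below the number of edges meeting [Z]. *)
Lemma core_removal Z : Z \subset R -> arcs (V :\: Z) + 6 * #|Z| <= arcs K + 6 * #|R|.
Proof.
move=> sZR; case: (coreK) => _ _ coreP.
have sKD : K \subset V :\: Z.
  apply/subsetP => z zK; rewrite inE (subsetP sKV) // andbT.
  by apply: contraL zK => /(subsetP sZR)/sRK.
have := core_arcs sKD (subsetDl _ _) coreP.
have -> : (V :\: Z) :\: K = R :\: Z by rewrite /R !setDDl setUC.
by have := cardsD R Z; rewrite (setIidPr sZR); have := subset_leq_card sZR; lia.
Qed.

(** In [K] with [w] added, the only vertex outside [K] is [w]. *)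
Lemma core_deg_le3 w : w \in R -> deg K w <= 3.
Proof.
move=> wR; case: (coreK) => _ _ coreP; have wK := sRK wR.
have [||v] := coreP (w |: K).
- by rewrite properUr // sub1set.
- by rewrite subUset sub1set sRV.
rewrite !inE => /andP[vK]; rewrite (negPf vK) orbF => /eqP->.
by apply: leq_trans; apply: deg_sub; apply: subsetUr.
Qed.

(** A closed [Z] would carry at most 6|Z| - 6 arcs by degeneracy, and the rest of [V] at most
    [arcs K + 6 * #|R|] less 6|Z|: fewer than 92 together. So every component of [V] meets [K]. *)
Lemma core_attached Z :
  Z \subset R -> Z != set0 -> closed_in V Z -> arcs K + 6 * #|R| < 98 -> False.
Proof.
move=> sZR; rewrite -card_gt0 => Z0 clZ lt98.
have sZV := subset_trans sZR (subsetDl _ _).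
have := degenerate_arcs (degenerate_sub sZR degR) Z0.
have := core_removal sZR; have := arcs_closed sZV clZ; lia.
Qed.

Lemma core_lt98 : arcs K + 6 * #|R| < 98.
Proof.
(* A complete core gives 20 + 6 * 12 = 92 or 30 + 6 * 11 = 96. *)
rewrite cardR; case/andP: szK; rewrite leq_eqVlt => /predU1P[K5 _|K5 K6].
  by move: arcsK; rewrite -K5; lia.
by move: arcsK; rewrite (_ : #|K| = 6); lia.
Qed.

(** If no edge of [R] has an end attached to [K], the vertices of [R] without a neighbour in [K]
    form a closed set, which is empty by [core_attached]. *)
Lemma isolated_or_edge :
  {in R &, forall u v, ~~ e u v} /\ {in R, forall u, 0 < deg K u} \/
  exists u v, [/\ u \in R, v \in R, 0 < deg K u & e u v].
Proof.
have [/exists_inP[u uR /exists_inP[v vR /andP[du euv]]]|none] :=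
  boolP [exists u in R, [exists v in R, (0 < deg K u) && e u v]].
  by right; exists u, v.
left; have noedge u v : u \in R -> v \in R -> 0 < deg K u -> ~~ e u v.
  move=> uR vR du; apply: contra none => euv.
  by apply/exists_inP; exists u => //; apply/exists_inP; exists v => //; apply/andP.
have attached : {in R, forall u, 0 < deg K u}.
  move=> u uR; rewrite lt0n; apply/negP => /eqP du.
  have := @core_attached [set z in R | deg K z == 0]; apply.
  - by apply/subsetP => z; rewrite inE => /andP[].
  - by apply/set0Pn; exists u; rewrite inE uR du.
  - apply/closed_inP => x y; rewrite inE => /andP[xR /eqP dx] yV exy.
    have yR : y \in R.
      rewrite inE yV andbT; apply: contraT; rewrite negbK => yK.
      by move: (deg_gt0 yK exy); rewrite dx.
    rewrite inE yR -leqn0 leqNgt /=; apply/negP => dy.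
    by have := noedge y x yR xR dy; rewrite eC exy.
  - exact: core_lt98.
split=> // u v uR vR; exact: noedge (attached u uR).
Qed.

Let neq_adj u v : e u v -> u != v.
Proof. by apply: contraTneq => ->; rewrite eI. Qed.

Let all_out s : all [in R] s -> all (fun z => z \notin K) s.
Proof. by apply: sub_all => z /sRK. Qed.

Lemma core_attach1 w s : w \in R -> 0 < deg K w -> path e w s -> uniq (w :: s) -> all [in R] s ->
  #|K| + size (w :: s) <= 8.
Proof.
move=> wR /deg_witness[x xK ewx] ws us sR.
by apply: (attach1 (x := x)) => //; [rewrite eC | rewrite /= sRK //= all_out].
Qed.

Lemma core_attach2 x x' w w' s s' : x \in K -> x' \in K -> e w x -> e w' x' ->
    path e w s -> path e w' s' -> uniq ((w :: s) ++ (w' :: s')) ->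
    all [in R] ((w :: s) ++ (w' :: s')) -> 8 < #|K| + (size (w :: s) + size (w' :: s')) ->
  x = x'.
Proof.
move=> xK x'K ewx ewx' ws ws' us sR lt8; apply/eqP; apply: contraLR lt8 => xx'.
by rewrite -leqNgt; apply: (attach2 (x := x) (x' := x')) => //; apply: all_out.
Qed.

(** With a core of 5 vertices, one, two or three vertices of [R] meet at least 3, 6 or 9 edges; with
    a core of 6 vertices, two of them meet at least 4. *)
Lemma core_removal1 u : u \in R -> 92 + 6 * 1 <= arcs K + 6 * #|R| + 2 * deg V u.
Proof.
move=> uR; have := @core_removal [set u]; rewrite sub1set cards1 => /(_ uR).
by move: arcsV; rewrite (arcs_D1 (sRV uR)); lia.
Qed.

Lemma core_removal2 u v : u \in R -> v \in R -> u != v ->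
  92 + 6 * 2 <= arcs K + 6 * #|R| + 2 * (deg V u + deg (V :\ u) v).
Proof.
move=> uR vR uv; have := @core_removal [set u; v]; rewrite cards2 uv.
rewrite subUset !sub1set uR vR => /(_ isT).
have -> : V :\: [set u; v] = (V :\ u) :\ v by rewrite -setDDl.
have vV : v \in V :\ u by rewrite !inE eq_sym uv sRV.
by move: arcsV; rewrite (arcs_D1 (sRV uR)) (arcs_D1 vV); lia.
Qed.

Lemma core_removal3 u v w : u \in R -> v \in R -> w \in R -> uniq [:: u; v; w] ->
  92 + 6 * 3 <= arcs K + 6 * #|R| + 2 * (deg V u + deg (V :\ u) v + deg (V :\ u :\ v) w).
Proof.
move=> uR vR wR; rewrite /= !inE !negb_or andbT => /andP[/andP[uv uw] vw].
have := @core_removal (u |: [set v; w]); rewrite cardsU1 cards2 !inE negb_or uv uw vw.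
rewrite !subUset !sub1set uR vR wR => /(_ isT).
have -> : V :\: (u |: [set v; w]) = (V :\ u) :\ v :\ w by rewrite -!setDDl.
have vV : v \in V :\ u by rewrite !inE eq_sym uv sRV.
have wV : w \in V :\ u :\ v by rewrite !inE eq_sym vw eq_sym uw sRV.
by move: arcsV; rewrite (arcs_D1 (sRV uR)) (arcs_D1 vV) (arcs_D1 wV); lia.
Qed.

Lemma core_indep_arcs : {in R &, forall u v, ~~ e u v} ->
  arcs V = arcs K + 2 * \sum_(w in R) deg K w.
Proof.
move=> indR; have dKR : [disjoint K & R].
  by rewrite -setI_eq0; apply/eqP/setP => z; rewrite !inE; case: (z \in K).
rewrite -{1}(setID V K) (setIidPr sKV) -/R arcsU // sum_degC.
rewrite [arcs R]big1 ?addn0 // => u uR.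
by apply: deg_eq0 => v; apply: indR.
Qed.

(** At least 31 edges run between [K] and the 11 vertices of [R], which take at most 3 each. So at
    least 9 of these take exactly 3; three are enough for [core6_P9]. *)
Lemma core_indep_deg3 : {in R &, forall u v, ~~ e u v} -> #|K| = 6 ->
  3 <= #|[set w in R | 3 <= deg K w]|.
Proof.
move=> indR K6; have := core_indep_arcs indR; have := arcsK.
have : \sum_(w in R) deg K w <= \sum_(w in R) (2 + (3 <= deg K w)).
  apply: leq_sum => w wR; have := core_deg_le3 wR; case: ltnP; lia.
rewrite big_split /= sum_nat_const cardR K6.
rewrite (_ : \sum_(w in R) (_ : bool) = #|[set w in R | 3 <= deg K w]|); first by lia.
rewrite -sum1_card big_mkcond [RHS]big_mkcond; apply: eq_bigr => w _.
by rewrite inE; case: (w \in R); case: (_ <= _).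
Qed.

(** Two vertices of [R] always meet at least 4 edges. An independent [R] is excluded by [core6_P9];
    an edge in [R] leaves the other vertices of [R] so few neighbours that this count or
    [core_attached] fails. *)
Lemma core_neq6 : #|K| <> 6.
Proof.
move=> K6; have K30 : arcs K <= 30 by move: arcsK; rewrite K6.
have R11 : #|R| = 11 by rewrite cardR K6.
have pair4 u v : u \in R -> v \in R -> u != v -> 4 <= deg V u + deg (V :\ u) v.
  by move=> uR vR uv; have := core_removal2 uR vR uv; rewrite R11; lia.
(* An edge of [R] with an attached end is a component of [R]: three vertices of [R] in a row from an
   attached one give a [P_9], and two neighbours of [u] in [R] would both have degree at most 1. *)
have iso u v : u \in R -> v \in R -> 0 < deg K u -> e u v ->
  (forall z, z \in R -> e u z -> z = v) /\ (forall z, z \in R -> e v z -> z = u).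
- move=> uR vR du euv; have uv := neq_adj euv.
  have no3 a b c : a \in R -> b \in R -> c \in R -> 0 < deg K a -> e a b -> e b c -> c = a.
    move=> aR bR cR da eab ebc; apply/eqP; apply: contraT => ca.
    have := @core_attach1 a [:: b; c] aR da; rewrite /= eab ebc !(in_cons, in_nil, orbF) negb_or.
    rewrite (neq_adj eab) (neq_adj ebc) eq_sym ca bR cR K6.
    by move=> /(_ isT isT isT).
  split=> z zR ez; last exact: no3 euv ez.
  apply/eqP; apply: contraT => zv.
  have leaf a b : a \in R -> b \in R -> e u a -> e u b -> b != a -> deg V a <= 1.
    move=> aR bR eua eub ba; rewrite degV.
    have -> : deg K a = 0.
      apply/eqP; apply: contraNT ba; rewrite -lt0n => da.
      by apply/eqP; apply: no3 da _ eub; rewrite // eC.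
    by apply: (deg_le_size (s := [:: u])) => t tR eat; rewrite inE; apply/eqP; apply: no3 eua eat.
  have := pair4 v z vR zR; rewrite eq_sym zv => /(_ isT).
  have d1 := leaf v z vR zR euv ez zv.
  have := leaf z v zR vR ez euv; rewrite eq_sym zv => /(_ isT).
  move/(leq_trans (deg_sub z (subsetDl V [set v]))) => d2.
  by rewrite leqNgt ltnS (leq_trans (leq_add d1 d2)).
case: isolated_or_edge => [[indR _]|[u [v [uR vR du euv]]]].
  case/card_gt2P: (core_indep_deg3 indR K6) => w1 [w2 [w3 []]].
  case=> /setIdP[w1R d1] /setIdP[w2R d2] /setIdP[w3R d3] [w12 w23 w31].
  apply: (core6_P9 (C := K) (w1 := w1) (w2 := w2) (w3 := w3)) => //.
    by rewrite /= !inE negb_or w12 w23 (eq_sym w1) w31.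
  by apply: all_out; rewrite /= w1R w2R w3R.
have [Nu Nv] := iso u v uR vR du euv; have [x xK eux] := deg_witness du.
have uv := neq_adj euv.
(* If [w] were attached elsewhere than at [x], then [v], [u], a Hamiltonian path of [K] and [w]
   would form a [P_9]. *)
have other w x' : w \in R -> w \notin [:: u; v] -> x' \in K -> e w x' -> x' = x.
  rewrite !(in_cons, in_nil, orbF) negb_or => wR /andP[wu wv] x'K ewx'.
  apply: (@core_attach2 x' x w u [::] [:: v]) => //; rewrite ?K6 /= ?euv //.
    by rewrite !inE !negb_or wu wv uv.
  by rewrite wR uR vR.
have degK1 w : w \in R -> w \notin [:: u; v] -> deg K w <= 1.
  move=> wR wuv; apply: (deg_le_size (s := [:: x])) => x' x'K ewx'.
  by rewrite inE (other w x').
have out w z : w \in R -> w \notin [:: u; v] -> z \in R -> e w z -> z \notin [:: u; v].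
  move=> wR; rewrite !(in_cons, in_nil, orbF) => wuv zR ewz; apply: contra wuv.
  move=> /pred2P[zE|zE]; move: ewz; rewrite zE eC.
    by move/(Nu w wR)->; rewrite eqxx orbT.
  by move/(Nv w wR)->; rewrite eqxx.
(* Two adjacent vertices [w] and [z] would meet at most 3 edges: [wx], [wz] and [zx]. *)
have lone w z : w \in R -> w \notin [:: u; v] -> 0 < deg K w -> z \in R -> ~~ e w z.
  move=> wR wuv dw zR; apply/negP => ewz; have [Nw Nz] := iso w z wR zR dw ewz.
  have zuv := out w z wR wuv zR ewz.
  have := pair4 w z wR zR (neq_adj ewz); rewrite degV.
  have := degK1 w wR wuv.
  have : deg R w <= 1.
    by apply: (deg_le_size (s := [:: z])) => t tR ewt; rewrite (Nw t tR ewt) mem_head.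
  have : deg (V :\ w) z <= 1; last first.
    by move=> d1 d2 d3; rewrite leqNgt ltnS (leq_trans (leq_add (leq_add d3 d2) d1)).
  apply: (deg_le_size (s := [:: x])) => t; rewrite !inE => /andP[tw tV] ezt.
  have [tK|tK] := boolP (t \in K); first by rewrite (other z t).
  by move: tw; rewrite (Nz t) ?eqxx // inE tK tV.
pose Z := R :\: [set u; v].
have inZ z : z \in Z = (z \notin [:: u; v]) && (z \in R) by rewrite !inE.
have Z9 : 9 <= #|Z|.
  rewrite cardsD R11; have := subset_leq_card (subsetIr R [set u; v]).
  by rewrite cards2 uv; lia.
(* If all of [Z] is attached, two of its vertices meet at most 2 edges; otherwise the unattached
   ones form a closed set. *)
have [Z0|/set0Pn[z]] := eqVneq [set z in Z | deg K z == 0] set0.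
  have /card_gt1P[w1 [w2 [w1Z w2Z w12]]] : 1 < #|Z| by apply: leq_trans Z9.
  have degZ w : w \in Z -> deg V w <= 1.
    move=> wZ; have := wZ; rewrite inZ => /andP[wuv wR].
    have dw : 0 < deg K w.
      by rewrite lt0n; apply/negP => dw; have := in_set0 w; rewrite -Z0 inE wZ dw.
    by rewrite degV (deg_eq0 (S := R)) ?addn0 ?degK1 // => z; apply: lone.
  have [w1R w2R] : w1 \in R /\ w2 \in R by move: w1Z w2Z; rewrite !inZ => /andP[_ ?] /andP[].
  have := pair4 w1 w2 w1R w2R w12.
  have d2 := leq_trans (deg_sub w2 (subsetDl V [set w1])) (degZ _ w2Z).
  by rewrite leqNgt ltnS (leq_trans (leq_add (degZ _ w1Z) d2)).
move=> zZ0; apply: (@core_attached [set z in Z | deg K z == 0]).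
- by apply/subsetP => t; rewrite inE inZ => /andP[/andP[]].
- by apply/set0Pn; exists z.
- apply/closed_inP => a b; rewrite inE inZ => /andP[/andP[auv aR] /eqP da] bV eab.
  have bR : b \in R.
    by rewrite inE bV andbT; apply/negP => bK; move: (deg_gt0 bK eab); rewrite da.
  have buv := out a b aR auv bR eab.
  rewrite inE inZ buv bR /= -leqn0 leqNgt; apply/negP => db.
  by have := lone b a bR buv db aR; rewrite eC eab.
- exact: core_lt98.
Qed.

(** Every vertex of [R] has degree at least 3. Edges inside [R] are ruled out by long paths and edge
    counts, and the set sought is [R] together with a vertex of [K] that has no neighbour in it. *)
Lemma core5_indep : #|K| = 5 ->
  exists I : {set T}, [/\ I \subset V, #|I| = 13 & {in I &, forall u v, ~~ e u v}].
Proof.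
move=> K5; have K20 : arcs K <= 20 by move: arcsK; rewrite K5.
have R12 : #|R| = 12 by rewrite cardR K5.
have deg3 u : u \in R -> 3 <= deg V u.
  by move=> uR; have := core_removal1 uR; rewrite R12; lia.
have seqE := (in_cons, in_nil, orbF).
(* By [core_attached], some vertex of [R] other than three given ones is attached to [K] or adjacent
   to one of the three. *)
have closing a b c : (forall z, z \in R -> z \notin [:: a; b; c] ->
    deg K z = 0 /\ {in [:: a; b; c], forall y, ~~ e z y}) -> False.
  move=> out; pose Z := R :\: [set y in [:: a; b; c]].
  have ZP z : z \in Z -> z \in R /\ z \notin [:: a; b; c].
    by case/setDP=> zR; rewrite inE.
  apply: (@core_attached Z); first exact: subsetDl.
  - rewrite -card_gt0 cardsD R12 subn_gt0.
    apply: leq_ltn_trans (subset_leq_card (subsetIr R [set y in [:: a; b; c]])) _.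
    by rewrite cardsE (leq_ltn_trans (card_size _)).
  - apply/closed_inP => z y /ZP[zR zn] yV ezy; have [dz nz] := out z zR zn.
    rewrite 2!inE; apply/andP; split; first by apply: contraL ezy => /nz.
    by rewrite inE yV andbT; apply/negP => yK; move: (deg_gt0 yK ezy); rewrite dz.
  - exact: core_lt98.
(* First case: a path [u], [v], [t] in [R] starts at an attached vertex. A fourth vertex of [R] on
   it would complete a [P_9], which confines the neighbours of its ends. *)
have [/existsP[[[u v] t]]|nop3] := boolP [exists p : T * T * T,
    [&& p.1.1 \in R, p.1.2 \in R, p.2 \in R, 0 < deg K p.1.1, e p.1.1 p.1.2,
        e p.1.2 p.2 & p.2 != p.1.1]].
  rewrite /= => /and5P[uR vR tR du /and3P[euv evt tu]]; exfalso.
  have uv := neq_adj euv; have vt := neq_adj evt.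
  have [x xK eux] := deg_witness du.
  have no4 a b c d : a \in R -> b \in R -> c \in R -> d \in R -> 0 < deg K a ->
      e a b -> e b c -> e c d -> uniq [:: a; b; c; d] -> False.
    move=> aR bR cR dR da eab ebc ecd uabcd.
    have := @core_attach1 a [:: b; c; d] aR da.
    by rewrite uabcd /= eab ebc ecd bR cR dR K5; move=> /(_ isT isT isT).
  have no31 a b c d y z : a \in R -> b \in R -> c \in R -> d \in R -> uniq [:: a; b; c; d] ->
      e a b -> e b c -> y \in K -> z \in K -> e a y -> e d z -> y = z.
    move=> aR bR cR dR uabcd eab ebc yK zK eay edz.
    apply: (@core_attach2 y z a d [:: b; c] [::]) => //; rewrite ?K5 /= ?eab ?ebc //.
    by rewrite aR bR cR dR.
  have [evu etv] : e v u /\ e t v by rewrite eC euv eC.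
  have Nt z : z \in R -> e t z -> z \in [:: u; v].
    move=> zR etz; apply: contraT; rewrite !seqE negb_or => /andP[zu zv].
    by have nz := neq_adj etz; case: (no4 u v t z) => //; distinct.
  have dt : 0 < deg K t.
    have := leq_trans (deg3 t tR) (eq_leq (degV t)); have := deg_le_size Nt.
    by case: (deg K t) => //= le2; rewrite add0n leqNgt ltnS le2.
  have Nu z : z \in R -> e u z -> z \in [:: v; t].
    move=> zR euz; apply: contraT; rewrite !seqE negb_or => /andP[zv zt].
    by have nz := neq_adj euz; case: (no4 t v u z) => //; distinct.
  (* If [u] and [t] are not adjacent, [deg3] gives [u] two neighbours in [K], so by [no31] no other
     vertex of [R] is attached. None is adjacent to [u], [v] or [t] either, contrary to
     [closing]. *)
  have [etu|etu] := boolP (e t u); last first.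
    have K2 : 2 <= deg K u.
      rewrite -(leq_add2r 1) (leq_trans (deg3 u uR)) // degV leq_add2l.
      apply: (deg_le_size (s := [:: v])) => z zR euz.
      have := Nu z zR euz; rewrite !seqE => /orP[//|/eqP zt].
      by move: etu; rewrite -zt eC euz.
    apply: (closing u v t) => z zR; rewrite !seqE !negb_or => /and3P[zu zv zt].
    have ezu : ~~ e z u.
      apply/negP => ezu; have := Nu z zR; rewrite eC ezu !seqE (negPf zv) (negPf zt).
      by move/(_ isT).
    have ezt : ~~ e z t.
      apply/negP => ezt; have := Nt z zR; rewrite eC ezt !seqE (negPf zv) (negPf zu).
      by move/(_ isT).
    have dz : deg K z = 0.
      apply: deg_eq0 => y yK; apply/negP => ezy.
      have [y' [y'K euy' /eqP[]]] := deg_other y K2.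
      by apply: (no31 u v t z) => //; distinct.
    split=> // y; rewrite !seqE => /or3P[] /eqP-> //; apply/negP => ezv.
    have := deg3 z zR; rewrite degV dz add0n leqNgt => /negP[].
    rewrite ltnS; apply: leq_trans (_ : 1 <= 2); last by [].
    apply: (deg_le_size (s := [:: v])) => w wR ezw; rewrite !seqE.
    apply: contraT => wv; case: (no4 u v z w) => //; first by rewrite eC.
    have wu : w != u by apply: contraNneq ezu => <-.
    by have zw := neq_adj ezw; distinct.
  (* Now [u], [v], [t] form a triangle joined to nothing else in [R]. Another attached vertex [w]
     has one neighbour [x'] in [K], hence a neighbour [w1] in [R], and [x'] is then the only
     possible neighbour of the triangle in [K]. The triangle meets at most 3 + 2 + 1 edges, where
     [core_removal3] requires 9. *)
  have eut : e u t by rewrite eC.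
  have Nv z : z \in R -> e v z -> z \in [:: u; t].
    move=> zR evz; apply: contraT; rewrite !seqE negb_or => /andP[zu zt].
    by have nz := neq_adj evz; case: (no4 u t v z) => //; distinct.
  have out z : z \in R -> z \notin [:: u; v; t] -> {in [:: u; v; t], forall y, ~~ e z y}.
    move=> zR; rewrite !seqE !negb_or => /and3P[zu zv zt] y.
    rewrite !seqE => /or3P[] /eqP->; rewrite eC; apply/negP.
    - by move/(Nu z zR); rewrite !seqE (negPf zv) (negPf zt).
    - by move/(Nv z zR); rewrite !seqE (negPf zu) (negPf zt).
    - by move/(Nt z zR); rewrite !seqE (negPf zu) (negPf zv).
  apply: (closing u v t) => w wR wn; split; last exact: out.
  apply/eqP; apply: contraT; rewrite -lt0n => /deg_witness[x' x'K ewx']; exfalso.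
  have nw := out w wR wn; move: wn; rewrite !seqE !negb_or => /and3P[wu wv wt].
  have dw1 : deg K w <= 1.
    apply: (deg_le_size (s := [:: x])) => y yK ewy; rewrite !seqE; apply/eqP.
    by symmetry; apply: (no31 u v t w) => //; distinct.
  have [w1 w1R eww1] : exists2 w1, w1 \in R & e w w1.
    apply: deg_witness; rewrite -(ltn_add2l 1) addn0.
    by rewrite (leq_trans (ltnW (deg3 w wR))) // degV leq_add2r.
  have [w1u w1v w1t] : [/\ w1 != u, w1 != v & w1 != t].
    by split; apply: contraTneq eww1 => ->; apply: nw; rewrite !seqE eqxx ?orbT.
  have ww1 := neq_adj eww1.
  have only a b y : a \in R -> b \in R -> e a b -> uniq [:: a; b; w; w1] -> y \in K ->
      e a y -> y = x'.
    move=> aR bR eab uabw yK eay.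
    apply: (@core_attach2 y x' a w [:: b] [:: w1]) => //; rewrite ?K5 /= ?eab ?eww1 //.
    by rewrite aR bR wR w1R.
  have du3 : deg V u <= 3.
    apply: (deg_le_size (s := [:: x'; v; t])) => y yV euy.
    have [yK|yK] := boolP (y \in K).
      by rewrite (only u v y) ?mem_head //; distinct.
    by rewrite in_cons Nu ?orbT // inE yK.
  have dv2 : deg (V :\ u) v <= 2.
    apply: (deg_le_size (s := [:: x'; t])) => y /setD1P[yu yV] evy.
    have [yK|yK] := boolP (y \in K).
      by rewrite (only v u y) ?mem_head //; distinct.
    have := Nv y; rewrite inE yK yV => /(_ isT evy); rewrite !seqE (negPf yu) /= => ->.
    by rewrite orbT.
  have dt1 : deg (V :\ u :\ v) t <= 1.
    apply: (deg_le_size (s := [:: x'])) => y /setD1P[yv /setD1P[yu yV]] ety.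
    have [yK|yK] := boolP (y \in K).
      by rewrite (only t v y) ?mem_head //; distinct.
    by have := Nt y; rewrite inE yK yV => /(_ isT ety); rewrite !seqE (negPf yu) (negPf yv).
  have uvt : uniq [:: u; v; t] by distinct.
  have := core_removal3 uR vR tR uvt; rewrite R12; have := leq_add (leq_add du3 dv2) dt1.
  by move: K20; clear; lia.
have pair_only u v t : u \in R -> v \in R -> t \in R -> 0 < deg K u -> e u v -> e v t -> t = u.
  move=> uR vR tR du euv evt; apply/eqP; apply: contraNT nop3 => tu.
  by apply/existsP; exists (u, v, t); apply/and5P; split=> //=; rewrite euv evt.
have rest2 u v : 1 < #|R :\: [set u; v]|.
  rewrite cardsD R12 ltn_subRL addn1 ltnS.
  by rewrite (leq_ltn_trans (subset_leq_card (subsetIr _ _))) // cards2; case: (u != v).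
(* By [core5_triple_P9] the vertices of [R] have in [K] only neighbours of [w1], so a vertex [d] of
   [K] missed by [w1] is missed by all of [R]. *)
have indep_case : {in R &, forall u v, ~~ e u v} -> exists I : {set T},
    [/\ I \subset V, #|I| = 13 & {in I &, forall u v, ~~ e u v}].
  move=> indR; have dK u : u \in R -> 3 <= deg K u.
    move=> uR; have := deg3 u uR.
    by rewrite degV (deg_eq0 (S := R) (v := u)) ?addn0 // => w; apply: indR.
  have [w1 [w2 [w1R w2R w12]]] : exists w1 w2, [/\ w1 \in R, w2 \in R & w1 != w2].
    by apply/card_gt1P; rewrite R12.
  have sub_nbrs w y : w \in R -> y \in K -> e w y -> e w1 y.
    move=> wR yK ewy; apply: contraT => ew1y; exfalso.
    have w1w : w1 != w by apply: contraNneq ew1y => ->.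
    have /card_gt1P[w3 [w4 []]] : 1 < #|R :\: [set w1; w]| by exact: rest2.
    move=> /setDP[w3R]; rewrite in_set2 negb_or => /andP[w31 w3w].
    move=> /setDP[w4R]; rewrite in_set2 negb_or => /andP[w41 w4w] w34.
    apply: (core5_triple_P9 (C := K) (w1 := w1) (w2 := w) (w3 := w3) (w4 := w4) (y := y)) => //;
      rewrite ?dK //.
      by distinct.
    by apply: all_out; rewrite /= w1R wR w3R w4R.
  have [d dK' ew1d] : exists2 d, d \in K & ~~ e w1 d.
    apply/exists_inP; apply: contraLR (core_deg_le3 w1R).
    rewrite negb_exists_in => /forall_inP all_nbr; rewrite -ltnNge.
    by rewrite deg_full ?K5 // => z /all_nbr; rewrite negbK.
  have dR w : w \in R -> ~~ e w d by move=> wR; apply: contra ew1d; apply: sub_nbrs.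
  exists (d |: R); split.
  - by rewrite subUset sub1set (subsetP sKV) // subsetDl.
  - by rewrite cardsU1 R12 (contraL (@sRK d)).
  - move=> u v /setU1P[->|uR] /setU1P[->|vR]; rewrite ?eI //; last exact: indR.
      by rewrite eC dR.
    exact: dR.
case: isolated_or_edge => [[/indep_case//]|[u [v [uR vR du euv]]]]; exfalso.
have uv := neq_adj euv; have evu : e v u by rewrite eC.
have deg_mate a b : a \in R -> b \in R -> 0 < deg K a -> e a b -> deg R b <= 1.
  move=> aR bR da eab; apply: (deg_le_size (s := [:: a])) => t tR ebt.
  by rewrite (pair_only a b t) ?mem_head.
have degK2 a b : a \in R -> b \in R -> 0 < deg K a -> e a b -> 2 <= deg K b.
  move=> aR bR da eab; rewrite -(leq_add2r 1) (leq_trans (deg3 b bR)) // degV leq_add2l.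
  exact: deg_mate eab.
have dv := degK2 u v uR vR du euv.
have du2 := degK2 v u vR uR (ltnW dv) evu.
(* As [u] has two neighbours in [K], the paths [v], [u] and [w], [z] could be attached to [K] at
   different vertices: 5 + 2 + 2 = 9. *)
have out w z : w \in R -> w != u -> w != v -> 0 < deg K w -> z \in R -> ~~ e w z.
  move=> wR wu wv dw zR; apply/negP => ewz; have [x xK ewx] := deg_witness dw.
  have [y [yK euy /eqP[]]] := deg_other x du2.
  have wz := neq_adj ewz.
  have zu : z != u.
    apply: contraNneq wv => zu; rewrite zu eC in ewz.
    by rewrite (pair_only v u w) // ltnW.
  have zv : z != v.
    by apply: contraNneq wu => zv; rewrite zv eC in ewz; rewrite (pair_only u v w).
  apply: (@core_attach2 y x u w [:: v] [:: z]) => //; rewrite ?K5 /= ?euv ?ewz //.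
    by distinct.
  by rewrite uR vR wR zR.
have nadj w : w \in R -> w != u -> w != v -> ~~ e w u /\ ~~ e w v.
  move=> wR wu wv; split; apply/negP; rewrite eC => ew.
    by case/eqP: wv; apply: (pair_only v u w) => //; apply: ltnW.
  by case/eqP: wu; apply: (pair_only u v w).
pose Un := [set w in R :\: [set u; v] | deg K w == 0].
have inUn w : w \in Un -> [/\ w \in R, w != u, w != v & deg K w = 0].
  by case/setIdP=> /setDP[wR]; rewrite in_set2 negb_or => /andP[wu wv] /eqP.
(* The unattached vertices other than [u] and [v] form a closed set, so there are none. The attached
   ones have no neighbour in [R], and [deg3] counts neighbours in [K]. *)
have dK w : w \in R -> w != u -> w != v -> 3 <= deg K w.
  move=> wR wu wv; have dw : 0 < deg K w.
    rewrite lt0n; apply/negP => dw; apply: (@core_attached Un).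
    - by apply/subsetP => z /inUn[].
    - by apply/set0Pn; exists w; rewrite inE dw andbT inE in_set2 negb_or wu wv.
    - apply/closed_inP => a b /inUn[aR au av da] bV eab.
      have bR : b \in R.
        by rewrite inE bV andbT; apply/negP => bK; move: (deg_gt0 bK eab); rewrite da.
      have [nau nav] := nadj a aR au av.
      have bu : b != u by apply: contraNneq nau => <-.
      have bv : b != v by apply: contraNneq nav => <-.
      rewrite inE inE in_set2 negb_or bu bv bR /= -leqn0 leqNgt; apply/negP => db.
      by have := out b a bR bu bv db aR; rewrite eC eab.
    - exact: core_lt98.
  by have := deg3 w wR; rewrite degV (deg_eq0 (S := R) (v := w)) ?addn0 // => z; apply: out.
have /card_gt1P[w1 [w2 []]] : 1 < #|R :\: [set u; v]| by exact: rest2.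
move=> /setDP[w1R]; rewrite in_set2 negb_or => /andP[w1u w1v].
move=> /setDP[w2R]; rewrite in_set2 negb_or => /andP[w2u w2v] w12.
have finish z z' : z \in R -> z' \in R -> z != z' -> w1 != z -> w1 != z' -> w2 != z ->
    w2 != z' -> e z z' -> 3 <= deg K z -> False.
  move=> zR z'R zz' w1z w1z' w2z w2z' ezz' dz.
  apply: (core5_pendant_P9 (C := K) (z := z) (v := z') (w1 := w1) (w2 := w2)) => //;
    rewrite ?dK //.
    by distinct.
  by apply: all_out; rewrite /= zR z'R w1R w2R.
(* At least 6 edges meet [u] or [v], and only one of them lies in [R]; so [u] or [v] has three
   neighbours in [K]. *)
have deg5 : 5 <= deg K u + deg K v.
  have := core_removal2 uR vR uv; rewrite R12.
  have -> : deg V u = deg K u + deg R u by exact: degV.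
  have : deg (V :\ u) v <= deg K v.
    apply: subset_leq_card; apply/subsetP => z; rewrite inE => /andP[/setD1P[zu zV] evz].
    rewrite inE evz andbT; apply: contraNT zu => zK; apply/eqP.
    by apply: (pair_only u v z) => //; rewrite inE zK.
  have := deg_mate v u vR uR (ltnW dv) evu.
  by move: K20; clear; lia.
have [du3|du3] := leqP 3 (deg K u); first by apply: (finish u v).
apply: (finish v u) => //; first by rewrite eq_sym.
by rewrite -(leq_add2l 2) (leq_trans deg5) // leq_add2r.
Qed.

End Core.

(** * Bipartite graphs *)

Section Bipartite.
Variables X Y : {set T}.
Hypotheses (dXY : [disjoint X & Y]) (X7 : #|X| = 7) (Y5 : #|Y| = 5).
Hypothesis bip : forall u v, e u v -> (u \in X) && (v \in Y) || (u \in Y) && (v \in X).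
Hypothesis degY : {in Y, forall y, 4 <= deg X y}.

Let YX y : y \in Y -> y \notin X.
Proof. by move=> yY; apply: contraL yY => yX; rewrite (disjointFr dXY yX). Qed.

Let eYX y x : y \in Y -> e y x -> x \in X.
Proof. by move=> yY /bip/orP[/andP[yX]|/andP[]//]; rewrite (negPf (YX yY)) in yX. Qed.

Let eXY x y : x \in X -> e x y -> y \in Y.
Proof. by move=> xX /bip/orP[/andP[]//|/andP[xY]]; rewrite (negPf (YX xY)) in xX. Qed.

(** With [k] vertices in [X] and [k + 1] in [Y]; the quantified [x] only serves as the default of
    [head]. *)
Definition alternating k q :=
  [/\ uniq q, sorted e q, size q = k.*2.+1 & forall x, head x q \in Y].

Lemma alternating_mem k q x j : alternating k q -> j <= k.*2 ->
  nth x q j \in if odd j then X else Y.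
Proof.
case=> uq /(sortedP x) pq szq hq; elim: j => [_|j IHj ltj]; first by rewrite nth0.
have := IHj (ltnW ltj); have := pq j; rewrite szq ltnS => /(_ ltj) exy.
by rewrite /=; case: (odd j) => ?; [apply: eXY exy | apply: eYX exy].
Qed.

Lemma search_alternating x p q k starts cs es todo : uniq (p ++ q) -> p =i X -> size p = 7 ->
    {subset q <= Y} -> all [in iota 7 (size q)] starts -> 0 < k ->
    all (fun c : nat * nat => [&& c.1 < size (p ++ q), c.2 < size (p ++ q) &
      e (nth x (p ++ q) c.1) (nth x (p ++ q) c.2)]) es ->
    all (fun c : nat * nat => (c.1 < size (p ++ q)) && (c.2 <= deg X (nth x (p ++ q) c.1))) cs ->
    search k.*2 k.*2 starts predT 7 cs todo (adj_of es) [::] ->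
  exists r, alternating k r.
Proof.
move=> upq pX sz7 qY /allP st7 k0 ges gcs; rewrite -sz7.
case/(search_sound (x0 := x) (A := p) (B := q) eC eI) => //.
- by rewrite double_gt0.
- apply: sub_all gcs => c; rewrite (deg_count _ _ pX) //.
  by move: upq; rewrite cat_uniq => /andP[].
move=> s [r [ss _ szr _ /andP[ur pr]]].
(* The path found may be too long and is cut to the required number of vertices. *)
exists (take k.*2.+1 (map (nth x (p ++ q)) (s :: r))); split.
- exact: take_uniq.
- exact: take_sorted.
- by rewrite size_takel //= size_map ltnS.
have := st7 s ss; rewrite mem_iota => /andP[le7s lts] y /=.
by rewrite qY // nth_cat sz7 ltnNge le7s mem_nth // ltn_subLR.
Qed.

Let out_X s : {subset s <= Y} -> all (fun z => z \notin X) s.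
Proof. by move=> sY; apply/allP => z /sY/YX. Qed.

(** Even positions of [q] lie in [Y] and odd ones in [X]. At most 4 of the 5 vertices of [Y] are on
    [q], which leaves the fresh vertex [y]. *)
Lemma alternating_parts k q x : alternating k q -> k <= 3 ->
  exists ys xs y, [/\ size ys = k.+1, size xs = k,
    uniq (xs ++ enum (X :\: [set z in xs])) /\ uniq (rcons ys y),
    {subset xs <= X} /\ {subset rcons ys y <= Y} &
    forall i, i < k -> e (nth x ys i) (nth x xs i) && e (nth x ys i.+1) (nth x xs i)].
Proof.
move=> altq k3; case: (altq) => uq /(sortedP x) pq szq _.
have memq := alternating_mem x altq.
pose ys := mkseq (fun i => nth x q i.*2) k.+1; pose xs := mkseq (fun i => nth x q i.*2.+1) k.
have uys : uniq ys.
  rewrite map_inj_in_uniq ?iota_uniq // => i j; rewrite !mem_iota => lti ltj /eqP.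
  by rewrite nth_uniq // ?szq ?ltnS ?leq_double // => /eqP/double_inj.
have uxs : uniq xs.
  rewrite map_inj_in_uniq ?iota_uniq // => i j; rewrite !mem_iota => lti ltj /eqP.
  by rewrite nth_uniq // ?szq ?ltnS ?ltn_double // => /eqP[] /double_inj.
have xsX : {subset xs <= X}.
  move=> z /mapP[i]; rewrite mem_iota => lti ->.
  by have := memq i.*2.+1; rewrite /= odd_double ltn_double; apply.
have ysY : {subset ys <= Y}.
  move=> z /mapP[i]; rewrite mem_iota => lti ->.
  by have := memq i.*2; rewrite odd_double leq_double; apply.
have [y yY yys] : exists2 y, y \in Y & y \notin ys.
  have : 0 < #|Y :\: [set z in ys]|.
    rewrite cardsD Y5 subn_gt0; apply: leq_ltn_trans (subset_leq_card (subsetIr _ _)) _.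
    by rewrite cardsE (leq_ltn_trans (card_size _)) // size_mkseq.
  by case/card_gt0P=> y /setDP[yY]; rewrite inE; exists y.
exists ys, xs, y; split; rewrite ?size_mkseq //.
- by rewrite uniq_cat_enumD // rcons_uniq yys.
- by split=> // z; rewrite mem_rcons inE => /predU1P[->|/ysY].
move=> i lti; have lti' : i < k.+1 by exact: ltnW.
rewrite !nth_mkseq //; apply/andP; split; first by rewrite pq // szq ltnS ltn_double.
by rewrite eC doubleS pq // szq ltnS -doubleS leq_double.
Qed.

Lemma alternating_step k q : 1 <= k.+1 <= 3 -> alternating k q -> exists r, alternating k.+1 r.
Proof.
move=> k3 altq; have [x _] : exists x, x \in Y by apply/set0Pn; rewrite -card_gt0 Y5.
have [|ys [xs [y [szys szxs [uX uY] [xsX ysY] eq_i]]]] := alternating_parts x altq; first by lia.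
have pX := mem_cat_enumD xsX; set p := xs ++ _ in uX pX.
have szp : size p = 7 by rewrite -X7 -(card_uniqP uX); apply: eq_card.
have szY : size (rcons ys y) = k.+2 by rewrite size_rcons szys.
have szpY : size (p ++ rcons ys y) = 7 + k.+2 by rewrite size_cat szp szY.
have nthX i : i < k -> nth x (p ++ rcons ys y) i = nth x xs i.
  move=> lti; rewrite nth_cat szp (_ : i < 7); last by lia.
  by rewrite nth_cat szxs lti.
have nthY i : i <= k -> nth x (p ++ rcons ys y) (7 + i) = nth x ys i.
  by move=> lei; rewrite nth_cat szp ltnNge leq_addr addKn nth_rcons szys ltnS lei.
have /allP/(_ k.+1) := alternating_search; rewrite mem_iota => /(_ k3).
apply: (search_alternating (x := x) (uniq_cat_out pX uX uY (out_X ysY)) pX szp ysY) => //.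
- by rewrite szY; apply/allP.
- apply/allP => c /flatten_mapP[i]; rewrite mem_iota /= add0n => lti.
  have := eq_i i lti; rewrite -nthX // -(nthY i) ?(ltnW lti) // -(nthY i.+1) // => /andP[e1 e2].
  by rewrite !inE => /pred2P[]-> /=; rewrite szpY ?e1 ?e2 andbT; lia.
apply/allP => c /mapP[i]; rewrite mem_iota /= add0n => lti -> /=.
rewrite szpY ltn_add2l lti degY // ysY // nth_cat szp ltnNge leq_addr addKn.
by rewrite mem_nth ?szY.
Qed.

(** Three steps lead from one vertex to a path with 4 vertices in [Y] and 3 in [X]. Its first vertex
    [b0] and the remaining vertex [y] of [Y] have four neighbours each, hence one off the path; a
    last search then finds 9 vertices. *)
Lemma bipartite_P9 : ~ P9_free.
Proof.
move=> free; have no4 q : ~ alternating 4 q.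
  by case=> uq pq szq _; have := free q uq pq; rewrite szq.
have [y0 y0Y] : exists y, y \in Y by apply/set0Pn; rewrite -card_gt0 Y5.
have alt0 : alternating 0 [:: y0] by [].
have [q1 alt1] := alternating_step (isT : 1 <= 1 <= 3) alt0.
have [q2 alt2] := alternating_step (isT : 1 <= 2 <= 3) alt1.
have [q altq] := alternating_step (isT : 1 <= 3 <= 3) alt2.
have [ys [xs [y [szys szxs [uX uY] [xsX ysY] eq_i]]]] := alternating_parts y0 altq isT.
have fresh v : v \in Y -> exists o, [/\ o \in X, e v o & o \notin xs].
  move=> vY; have [/exists_inP[o oX /andP[evo oxs]]|none] :=
    boolP [exists o in X, e v o && (o \notin xs)]; first by exists o.
  have := degY vY; rewrite leqNgt ltnS -szxs deg_le_size // => o oX evo.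
  apply: contraNT none => oxs; apply/exists_inP; exists o => //; by rewrite evo.
case: ys szys ysY uY eq_i => [|b0 [|b1 [|b2 [|b3 []]]]] // _ ysY uY eq_i.
rewrite -[rcons _ _]/[:: b0; b1; b2; b3; y] in ysY uY.
have [o1 [o1X eyo1 o1xs]] : exists o, [/\ o \in X, e y o & o \notin xs].
  by apply: fresh; rewrite ysY // !inE eqxx ?orbT.
have [o2 [o2X eb0o2 o2xs]] : exists o, [/\ o \in X, e b0 o & o \notin xs].
  by apply: fresh; rewrite ysY // !inE eqxx ?orbT.
move: uX; rewrite cat_uniq => /andP[uxs _].
case: xs szxs xsX uxs eq_i o1xs o2xs {fresh} => [|a0 [|a1 [|a2 []]]] // _ xsX uxs eq_i o1xs o2xs.
have /andP[e00 e10] := eq_i 0 isT; have /andP[e11 e21] := eq_i 1 isT.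
have /andP[e22 e32] := eq_i 2 isT; rewrite /= in e00 e10 e11 e21 e22 e32.
have cs_ok p (sz7 : size p = 7) : all (fun c : nat * nat =>
    (c.1 < size (p ++ [:: b0; b1; b2; b3; y])) &&
    (c.2 <= deg X (nth y (p ++ [:: b0; b1; b2; b3; y]) c.1))) [seq (7 + i, 4) | i <- iota 0 5].
  apply/allP => c /mapP[i]; rewrite mem_iota /= add0n => lti ->.
  rewrite size_cat sz7 ltn_add2l lti degY // ysY // nth_cat sz7 ltnNge leq_addr addKn.
  exact: mem_nth.
have uo1 : uniq [:: a0; a1; a2; o1].
  by rewrite -[[:: _; _; _; _]]/(rcons [:: a0; a1; a2] o1) rcons_uniq o1xs.
have sub_o1 : {subset [:: a0; a1; a2; o1] <= X}.
  move=> z; rewrite -[[:: _; _; _; _]]/(rcons [:: a0; a1; a2] o1) mem_rcons inE.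
  by case/predU1P=> [->|/xsX].
have [eq_o|neq_o] := eqVneq o1 o2.
  have := size_cat_enumD uo1 sub_o1; rewrite X7.
  have := mem_cat_enumD sub_o1; have := uniq_cat_enumD X uo1.
  case: (enum _) => [|r1 [|r2 [|r3 []]]] // up pX _.
  have ges : all (fun c : nat * nat => [&& c.1 < 12, c.2 < 12 &
      e (nth y [:: a0; a1; a2; o1; r1; r2; r3; b0; b1; b2; b3; y] c.1)
        (nth y [:: a0; a1; a2; o1; r1; r2; r3; b0; b1; b2; b3; y] c.2)])
      [:: (11, 3), (7, 3) & alternating_edges 3].
    by rewrite /= eyo1 eq_o eb0o2 e00 e10 e11 e21 e22 e32.
  by case: (search_alternating (x := y) (k := 4)
    (p := [:: a0; a1; a2; o1; r1; r2; r3]) (starts := [:: 11])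
    (uniq_cat_out pX up uY (out_X ysY)) pX
    (erefl 7) ysY isT isT ges (cs_ok [:: a0; a1; a2; o1; r1; r2; r3] (erefl 7))
    alternating_search4_closed) => r /no4.
have uo2 : uniq [:: a0; a1; a2; o1; o2].
  rewrite -[[:: _; _; _; _; _]]/(rcons [:: a0; a1; a2; o1] o2) rcons_uniq uo1 andbT.
  by rewrite -[[:: _; _; _; _]]/(rcons [:: a0; a1; a2] o1) mem_rcons inE negb_or eq_sym neq_o.
have sub_o2 : {subset [:: a0; a1; a2; o1; o2] <= X}.
  move=> z; rewrite -[[:: _; _; _; _; _]]/(rcons [:: a0; a1; a2; o1] o2) mem_rcons inE.
  by case/predU1P=> [->|/sub_o1].
have := size_cat_enumD uo2 sub_o2; rewrite X7.
have := mem_cat_enumD sub_o2; have := uniq_cat_enumD X uo2.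
case: (enum _) => [|r1 [|r2 []]] // up pX _.
have ges : all (fun c : nat * nat => [&& c.1 < 12, c.2 < 12 &
    e (nth y [:: a0; a1; a2; o1; o2; r1; r2; b0; b1; b2; b3; y] c.1)
      (nth y [:: a0; a1; a2; o1; o2; r1; r2; b0; b1; b2; b3; y] c.2)])
    [:: (11, 3), (7, 4) & alternating_edges 3].
  by rewrite /= eyo1 eb0o2 e00 e10 e11 e21 e22 e32.
by case: (search_alternating (x := y) (k := 4)
  (p := [:: a0; a1; a2; o1; o2; r1; r2]) (starts := [:: 11])
  (uniq_cat_out pX up uY (out_X ysY)) pX
  (erefl 7) ysY isT isT ges (cs_ok [:: a0; a1; a2; o1; o2; r1; r2] (erefl 7))
  alternating_search4) => r /no4.
Qed.

End Bipartite.

End Graph.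

(** * Three colours *)

Lemma P9_free_sub (T : finType) (e e' : rel T) : subrel e' e -> P9_free e -> P9_free e'.
Proof. by move=> sub free p up /(sub_sorted sub); apply: free. Qed.

Lemma exists_subset (T : finType) (A : {set T}) n : n <= #|A| ->
  exists2 B : {set T}, B \subset A & #|B| = n.
Proof.
case/card_geqP=> s [us <- sA]; exists [set x in s]; last by rewrite cardsE (card_uniqP us).
by apply/subsetP => x; rewrite inE => /sA.
Qed.

(** Only five vertices of [Y] and the edges between them and [X] are kept. *)
Lemma half_bipartite_P9 (T : finType) (e : rel T) (X Y : {set T}) :
    symmetric e -> irreflexive e -> [disjoint X & Y] -> #|X| = 7 -> 5 <= #|Y| ->
    {in Y, forall y, 4 <= deg e X y} -> ~ P9_free e.
Proof.
move=> eC eI dXY X7 /exists_subset[Z sZY Z5] degY.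
pose e' := [rel u v | e u v && ((u \in X) && (v \in Z) || (u \in Z) && (v \in X))].
have sub : subrel e' e by move=> u v /andP[].
move=> /(P9_free_sub sub); apply: (@bipartite_P9 T e' _ _ X Z) => //.
- by move=> u v; rewrite /= eC orbC ![(v \in _) && _]andbC.
- by move=> u; rewrite /= eI.
- by apply: disjointWr dXY.
- by move=> u v /andP[].
move=> z zZ; apply: leq_trans (degY z (subsetP sZY z zZ)) _; apply: subset_leq_card.
by apply/subsetP => x; rewrite inE => /andP[xX ezx]; rewrite inE xX /= ezx zZ xX orbT.
Qed.

Lemma pigeonhole (J : finType) (P : pred J) (F : J -> nat) m :
  #|P| * m < \sum_(j | P j) F j -> exists2 j, P j & m < F j.
Proof.
move=> ltF; apply/exists_inP; apply: contraLR ltF.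
rewrite negb_exists_in -leqNgt => /forall_inP leF.
by rewrite -sum_nat_const; apply: leq_sum => j /leF; rewrite -leqNgt.
Qed.

Lemma card_cover (J T : finType) (P : pred J) (A : {set T}) (Q : J -> pred T) :
    {in A, forall x, exists2 j, P j & Q j x} ->
  #|A| <= \sum_(j | P j) #|[set x in A | Q j x]|.
Proof.
move=> coverA.
have cardE j : #|[set x in A | Q j x]| = \sum_(x in A) Q j x.
  rewrite -sum1_card big_mkcond [RHS]big_mkcond; apply: eq_bigr => x _.
  by rewrite inE; case: (x \in A); case: (Q j x).
under eq_bigr do rewrite cardE; rewrite exchange_big -sum1_card.
by apply: leq_sum => x /coverA[j Pj Qjx]; rewrite (bigD1 j) // Qjx.
Qed.

Section ColourClasses.
Variables (T : finType) (e : 'I_3 -> rel T).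
Hypotheses (eC : forall i, symmetric (e i)) (eI : forall i, irreflexive (e i)).
Hypothesis cover : forall x y, x != y -> exists i, e i x y.
Hypothesis free : forall i, P9_free (e i).

Let card_others (i : 'I_3) : #|predC1 i| = 2.
Proof. by have := cardC1 i; rewrite card_ord. Qed.

Lemma arcs_cover (P : pred 'I_3) (S : {set T}) :
    {in S &, forall x y, x != y -> exists2 i, P i & e i x y} ->
  #|S| * #|S|.-1 <= \sum_(i | P i) arcs (e i) S.
Proof.
move=> coverS; rewrite /arcs exchange_big -sum_nat_const; apply: leq_sum => v vS.
have -> : #|S|.-1 = #|S :\ v| by have := cardsD1 v S; rewrite vS => ->.
apply: leq_trans (card_cover (P := P) (Q := fun i => e i v) _) _.
  by move=> w /setD1P[wv wS]; apply: coverS; rewrite // eq_sym.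
apply: leq_sum => i _; apply: subset_leq_card; apply/subsetP => w.
by rewrite !inE => /andP[/andP[_ ->]].
Qed.

Lemma no_closed78_or (f : rel T) (V : {set T}) : no_closed78 f V \/
  exists S : {set T}, [/\ S \subset V, closed_in f V S & #|S| = 7 \/ #|S| = 8].
Proof.
case: (boolP [exists S : {set T}, [&& S \subset V, closed_in f V S &
    (#|S| == 7) || (#|S| == 8)]]).
  by case/existsP=> S /and3P[sSV clS /pred2P szS]; right; exists S.
move=> none; left => S sSV clS; split=> szS; case/existsP: none; exists S;
  by rewrite sSV clS szS.
Qed.

Lemma closed_colour_false i (S : {set T}) : #|T| = 17 -> closed_in (e i) setT S ->
  7 <= #|S| <= 8 -> False.
Proof.
move=> T17 /closed_inP clS /andP[/exists_subset[X sXS X7] S8].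
have dXY : [disjoint X & ~: S] by rewrite -subsets_disjoint.
have Y9 : 9 <= #|~: S| by rewrite cardsCs setCK T17; lia.
have coverX y x : y \in ~: S -> x \in X -> exists2 j, j != i & e j y x.
  rewrite inE => yS /(subsetP sXS) xS; have [|j ejyx] := @cover y x.
    by apply: contraNneq yS => ->.
  exists j => //; apply: contraNneq yS => ji; apply: (clS x y xS (in_setT y)).
  by rewrite -ji eC.
(* Two colours on the 7 edges from [y] to [X] repeat one of them 4 times; the same argument on the 9
   vertices [y] fixes a colour for 5 of them. *)
have degY : {in ~: S, forall y, exists2 j, j != i & 4 <= deg (e j) X y}.
  move=> y yS; apply: pigeonhole; rewrite [#|_|]card_others.
  have := card_cover (P := predC1 i) (A := X) (Q := fun j => e j y) (fun x => coverX y x yS).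
  by rewrite X7.
have [j ji Yj] : exists2 j, j != i & 4 < #|[set y in ~: S | 4 <= deg (e j) X y]|.
  apply: pigeonhole; rewrite [#|_|]card_others.
  exact: leq_trans Y9 (card_cover degY).
apply: (half_bipartite_P9 (eC j) (eI j) (X := X) (Y := [set y in ~: S | 4 <= deg (e j) X y])) => //.
- by apply: disjointWr dXY; apply/subsetP => y; rewrite inE => /andP[].
by move=> y; rewrite inE => /andP[].
Qed.

(** The other two colours share 156 arcs, so one has at least 78 of them. This exceeds the 72 of
    [arcs_bound], and also the 42 + 30 or 56 + 20 possible when a closed set of size 7 or 8 splits
    off. *)
Lemma independent_false i (I : {set T}) : #|I| = 13 ->
  {in I &, forall u v, ~~ e i u v} -> False.
Proof.
move=> I13 indI.
have [j ji arcsj] : exists2 j, j != i & 77 < arcs (e j) I.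
  apply: pigeonhole; rewrite [#|_|]card_others.
  suff /(leq_trans _) : #|I| * #|I|.-1 <= \sum_(j | j != i) arcs (e j) I by apply; rewrite I13.
  apply: arcs_cover => x y xI yI /cover[j ejxy]; exists j => //.
  by apply: contraTneq ejxy => ->; apply: indI.
case: (no_closed78_or (e j) I) => [no78|[S [sSI clS szS]]].
  by have := arcs_bound (eC j) (eI j) (@free j) no78; rewrite I13; lia.
move: arcsj; rewrite (arcs_closed (eC j) sSI clS).
have := arcs_le (eI j) S; have := arcs_le (eI j) (I :\: S).
have := cardsD I S; rewrite (setIidPr sSI) I13 => ->.
by case: szS => ->; lia.
Qed.

Lemma colouring17_false : #|T| = 17 -> False.
Proof.
move=> T17; have cardT17 : #|[set: T]| = 17 by rewrite cardsT.
(* There are 17 * 16 = 272 arcs, more than 3 * 90. *)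
have [i _ arcsi] : exists2 i, predT i & 90 < arcs (e i) setT.
  apply: pigeonhole; rewrite card_ord.
  suff /(leq_trans _) : #|[set: T]| * #|[set: T]|.-1 <= \sum_(i | predT i) arcs (e i) setT.
    by apply; rewrite cardT17.
  by apply: arcs_cover => x y _ _ /cover[j ejxy]; exists j.
have {}arcsi : 92 <= arcs (e i) setT.
  move: arcsi; rewrite leq_eqVlt => /predU1P[odd91|//].
  by have := even_arcs (eC i) (eI i) setT; rewrite -odd91.
case: (no_closed78_or (e i) setT) => [no78|[S [_ clS szS]]]; last first.
  by apply: closed_colour_false T17 clS _; case: szS => ->.
have [K coreK szK] := dense_core (eC i) (eI i) (@free i) no78 cardT17 arcsi.
have [K6|K6] := eqVneq #|K| 6.
  by case: (core_neq6 (eC i) (eI i) (@free i) cardT17 arcsi coreK szK).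
have K5 : #|K| = 5 by lia.
have [I [_ I13 indI]] := core5_indep (eC i) (eI i) (@free i) cardT17 arcsi coreK szK K5.
exact: independent_false I13 indI.
Qed.

End ColourClasses.

Lemma contains_P9 (H : sgraph) : ~~ contains H (path_graph 9) -> P9_free (@adj H).
Proof.
move=> noP9 p up pp; rewrite leqNgt; apply: contra noP9 => lt8p.
have x0 : H by case: p lt8p {up pp}.
have ltp (i : 'I_9) : i < size p by apply: leq_trans lt8p.
apply/existsP; exists [ffun i : 'I_9 => nth x0 p i]; apply/andP; split.
  apply/injectiveP => i j; rewrite !ffunE => /eqP; rewrite nth_uniq ?ltp // => /eqP.
  exact: val_inj.
apply/forallP => i; apply/forallP => j; apply/implyP => /orP[]/eqP ij; rewrite !ffunE.
  by rewrite -ij (sortedP x0 pp) // ij ltp.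
by rewrite adj_sym -ij (sortedP x0 pp) // ij ltp.
Qed.

Theorem theorem8 : R3 (path_graph 9) <= 17.
Proof.
rewrite /R3; case: ex_minnP => m _; apply; apply/forallP => c.
apply: contraT => /existsPn no_mono; exfalso.
apply: (@colouring17_false 'I_17 (fun i => @adj (color_class c i))).
- by move=> i; apply: (@adj_sym (color_class c i)).
- by move=> i; apply: (@adj_irr (color_class c i)).
- by move=> x y xy; exists (c [set x; y]); rewrite /= xy eqxx.
- by move=> i; apply: (@contains_P9 (color_class c i)).
exact: card_ord.
Qed.
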